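(* Let $E\subset\mathbb{H}^n$ be a closed set. Then $\lambda:\operatorname{Unp}(E)\setminus E\to\mathbb{R}$ is a continuous function, where $\lambda(p)$ is the common curvature of all the minimizing geodesics going from $\xi_E(p)$ to $p$.
   Context: $\mathbb{H}^n$ is $\mathbb{R}^{2n+1}$ with coordinates $(x_1,y_1,\ldots,x_n,y_n,t)$, with the left-invariant vector fields $X_i=\partial_{x_i}+y_i\partial_t$, $Y_i=\partial_{y_i}-x_i\partial_t$ ($1\le i\le n$), $T=\partial_t$, and $n\ge 1$. The horizontal distribution $\mathcal{H}$ is spanned by the $X_i,Y_i$; $\langle\cdot,\cdot\rangle$ is the Riemannian metric making $\{X_i,Y_i,T\}$ orthonormal; $J(X_i)=Y_i$, $J(Y_i)=-X_i$, $J(T)=0$. $\nabla$ is the pseudo-hermitian connection: the metric connection for which all $X_i,Y_i,T$ are parallel. $d$ is the Carnot-Carathéodory distance (infimum of Riemannian lengths of piecewise smooth curves tangent to $\mathcal{H}$). $\operatorname{Unp}(E)$ is the set of points with a unique $d$-nearest point in $E$, and $\xi_E(p)$ is that point. A unit-speed geodesic of curvature $\lambda$ is a smooth horizontal unit-speed curve with $\nabla_{\dot\gamma}\dot\gamma+\lambda J(\dot\gamma)=0$; every minimizing geodesic parameterized by arc-length is of this form for a unique $\lambda\in\mathbb{R}$. For $p\in\operatorname{Unp}(E)\setminus E$, the minimizing geodesic from $\xi_E(p)$ to $p$ is unique if the two points do not lie in the same vertical line (line parallel to the $t$-axis); otherwise there are several, all with the same curvature. Hence $\lambda(p)$ is well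 defined. *)

(* Defs.v *)
From HB Require Import structures.
From mathcomp Require Import all_boot all_order all_algebra.
From mathcomp Require Import all_classical all_reals all_analysis.
Import Order.TTheory GRing.Theory Num.Theory.
Import numFieldNormedType.Exports.

Set Implicit Arguments.
Unset Strict Implicit.
Unset Printing Implicit Defensive.

Local Open Scope classical_set_scope.
Local Open Scope ring_scope.

(* The point (x_1, y_1, ..., x_n, y_n, t) is encoded as ((x, y), t); the
   library's product topology on this type is the Euclidean one. Tangent
   vectors at any point are given by their Cartesian coordinates, hence live in
   the same type. *)
Notation heis R n := ('rV[R]_n * 'rV[R]_n * R^o)%type.

Section Heisenberg.
Context {R : realType} {n : nat}.
Implicit Types (p q u v : heis R n) (i : 'I_n) (g V : R -> heis R n).

Definition xc i p : R := p.1.1 0 i.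
Definition yc i p : R := p.1.2 0 i.
Definition tc p : R := p.2.

Definition Xf i p : heis R n := ((delta_mx 0 i, 0), yc i p).
Definition Yf i p : heis R n := ((0, delta_mx 0 i), - xc i p).
Definition Tf p : heis R n := ((0, 0), 1).

(* The coefficient of v along Tf in the frame (Xf, Yf, Tf) at p; the
   coefficients along Xf i and Yf i are xc i v and yc i v, see frameE. *)
Definition tcoef p v : R :=
  tc v - \sum_(i < n) (yc i p * xc i v - xc i p * yc i v).

Lemma frameE p v :
  v = \sum_(i < n) (xc i v *: Xf i p + yc i v *: Yf i p) + tcoef p v *: Tf p.
Proof.
have E1 (F : 'I_n -> heis R n) :
    \sum_(i < n) F i =
    ((\sum_(i < n) (F i).1.1, \sum_(i < n) (F i).1.2), \sum_(i < n) (F i).2).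
  elim: (index_enum _) => [|i s IHs]; first by rewrite !big_nil.
  by rewrite !big_cons IHs; case: (F i) => [[]].
rewrite E1; case: v => [[x y] t]; congr ((_, _), _) => /=.
- rewrite scaler0 addr0 [LHS]row_sum_delta; apply: eq_bigr => i _ /=.
  by rewrite scaler0 addr0.
- rewrite scaler0 addr0 [LHS]row_sum_delta; apply: eq_bigr => i _ /=.
  by rewrite scaler0 add0r.
- rewrite /tcoef /tc /= /GRing.scale /= mulr1 addrC.
  rewrite [X in _ - X](_ : _ =
    \sum_(i < n) (xc i (x, y, t) * yc i p + yc i (x, y, t) * - xc i p)).
    by rewrite subrK.
  by apply: eq_bigr => i _; rewrite mulrN mulrC (mulrC (xc i p)).
Qed.

(* The Riemannian metric for which (Xf, Yf, Tf) is orthonormal. *)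
Definition metric p u v : R :=
  \sum_(i < n) (xc i u * xc i v + yc i u * yc i v) + tcoef p u * tcoef p v.

Definition mnorm p v : R := Num.sqrt (metric p v v).

(* The linear map with J (Xf i) = Yf i, J (Yf i) = - Xf i and J Tf = 0. *)
Definition Jmap p v : heis R n :=
  \sum_(i < n) (xc i v *: Yf i p - yc i v *: Xf i p).

Definition horizontal p v : Prop :=
  exists a b : 'I_n -> R, v = \sum_(i < n) (a i *: Xf i p + b i *: Yf i p).

Definition smooth (f : R -> R) : Prop :=
  forall (k : nat) (s : R), derivable (derive1n k f) s 1.

Definition smooth_curve g : Prop :=
  (forall i, smooth (xc i \o g) /\ smooth (yc i \o g)) /\ smooth (tc \o g).

Definition velocity g (s : R) : heis R n :=
  ((\row_i derive1 (xc i \o g) s, \row_i derive1 (yc i \o g) s),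
   derive1 (tc \o g) s).

(* The covariant derivative, along g, of the vector field V along g: as the
   frame is parallel, only its coefficients in the frame are differentiated. *)
Definition covderiv g V (s : R) : heis R n :=
  \sum_(i < n) (derive1 (xc i \o V) s *: Xf i (g s) +
                derive1 (yc i \o V) s *: Yf i (g s)) +
  derive1 (fun r => tcoef (g r) (V r)) s *: Tf (g s).

(* Piecewise smooth curves [a, b] -> H^n tangent to the horizontal
   distribution. Smoothness on a closed interval means being the restriction of
   a smooth map on R. Values of g outside [a, b] are irrelevant. *)
Definition horizontal_curve (a b : R) g : Prop :=
  exists s : seq R,
    [/\ path <%R a s, last a s = b &
      forall k, (k < size s)%N ->
        exists2 h : R -> heis R n, smooth_curve h &
          forall r, r \in `[nth a (a :: s) k, nth a s k] ->
            g r = h r /\ horizontal (h r) (velocity h r)].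

(* For a piecewise smooth curve, velocity is meaningless at the finitely many
   break points, which the integral ignores. *)
Definition curve_length (a b : R) g : \bar R :=
  (\int[lebesgue_measure]_(s in `[a, b]) (mnorm (g s) (velocity g s))%:E)%E.

Definition ccdist p q : \bar R :=
  ereal_inf [set l | exists (a b : R) (g : R -> heis R n),
    [/\ horizontal_curve a b g, g a = p, g b = q & l = curve_length a b g]].

Definition nearest (E : set (heis R n)) p : set (heis R n) :=
  [set q | E q /\ forall r, E r -> (ccdist p q <= ccdist p r)%E].

Definition Unp (E : set (heis R n)) : set (heis R n) :=
  [set p | exists! q, nearest E p q].

(* Meaningful for p in Unp E. *)
Definition xi (E : set (heis R n)) p : heis R n := get (nearest E p).

Definition geodesic (lam L : R) g : Prop :=
  smooth_curve g /\
  forall s, s \in `[0, L] ->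
    [/\ horizontal (g s) (velocity g s),
        mnorm (g s) (velocity g s) = 1 &
        covderiv g (velocity g) s + lam *: Jmap (g s) (velocity g s) = 0].

Definition minimizing_geodesic (lam L : R) g p q : Prop :=
  [/\ 0 < L, geodesic lam L g, g 0 = p, g L = q &
      curve_length 0 L g = ccdist p q].

(* The common curvature of the minimizing geodesics from xi E p to p;
   meaningful for p in Unp E `\` E. *)
Definition curvature (E : set (heis R n)) p : R :=
  get [set lam | exists L g, minimizing_geodesic lam L g (xi E p) p].

End Heisenberg.

(* Main.v *)
Require Import Defs.
From mathcomp Require Import all_boot all_order all_algebra.
From mathcomp Require Import all_classical all_reals all_analysis.
From mathcomp Require Import measurable_realfun ring lra.
Import Order.TTheory GRing.Theory Num.Theory.
Import numFieldNormedType.Exports.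
Local Open Scope classical_set_scope.
Local Open Scope ring_scope.

(** The distance is computed explicitly, and the theorem then follows from a
    compactness argument.

    Up to left translation (see [disp]), the horizontal velocity of a geodesic of
    curvature [lam] turns with constant angular speed [- lam], and after length
    [L] the end point is, up to a rotation, a function of [L] and of the half
    angle [x = lam L / 2]: if [N] is the squared norm of the horizontal part and [tau]
    the vertical coordinate of the end point, then [N = L ^ 2 sinc x ^ 2] and
    [2 tau = L ^ 2 kap x] (see [geodesic_endpoint]). An intermediate value
    argument ([endpoint_exists]) shows that every point other than the origin is
    reached with some [x] in [[- pi, pi]].

    Geodesics with [|x| <= pi] minimize length. This is a calibration argument:
    along a horizontal curve starting at the origin, with arc length [sigma] and
    for [|a| sigma < pi], the quantity
    [sigma - a cot (a sigma) N - 2 a tau] is nondecreasing, because its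
    derivative with respect to [sigma] is a sum of squares ([potential_le]). For
    [a = x / L] this bounds the length of any competitor from below by [L]
    ([endpoint_le_length]). Hence the distance is the [L] of the end point equations ([ccdist_endpoint]), and since
    [(sinc x ^ 2, kap x)] determines [x] ([sinc_kap_inj]) all the minimizing
    geodesics between two given points have the same curvature [2 x / L]
    ([reach_curvature]).

    It remains to vary the end points. The parameters [(x, L)] stay in a
    compact set and are determined by the end points, so they depend
    continuously on them ([reach_cvg]); in particular the distance is continuous
    off the diagonal. By the same compactness principle the nearest point
    depends continuously on [p] ([xi_cvg]): the limit points of [xi E p] are
    nearest points of the limit of [p], and the latter has only one. Composing
    the two gives the continuity of the curvature. *)

(** * Derivatives of real functions *)

Section Derivatives.
Context {R : realType}.
Implicit Types (f g : R -> R) (a b x : R).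

Lemma derD {f g x a b} : is_derive x 1 f a -> is_derive x 1 g b ->
  is_derive x 1 (fun s => f s + g s) (a + b).
Proof. by move=> *; exact: is_deriveD. Qed.

Lemma derB {f g x a b} : is_derive x 1 f a -> is_derive x 1 g b ->
  is_derive x 1 (fun s => f s - g s) (a - b).
Proof. by move=> *; exact: is_deriveB. Qed.

Lemma derM {f g x a b} : is_derive x 1 f a -> is_derive x 1 g b ->
  is_derive x 1 (fun s => f s * g s) (f x * b + g x * a).
Proof. by move=> *; exact: is_deriveM. Qed.

Lemma der_cst {x a} : is_derive x 1 (fun _ : R => a) 0.
Proof. exact: is_derive_cst. Qed.

Lemma der_id {x} : is_derive x 1 (fun s : R => s) 1.
Proof. exact: is_derive_id. Qed.

Lemma derZ {f x a b} : is_derive x 1 f b ->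
  is_derive x 1 (fun s => a * f s) (a * b).
Proof.
move=> df; apply: is_derive_eq (derM der_cst df) _ => /=.
by rewrite mulr0 addr0.
Qed.

Lemma derX {f x a n} : is_derive x 1 f a ->
  is_derive x 1 (fun s => f s ^+ n.+1) (n.+1%:R * f x ^+ n * a).
Proof.
by move=> df; have := is_deriveX n.+1 df; rewrite exprfctE.
Qed.

Lemma der_comp {f g x a b} : is_derive x 1 g b -> is_derive (g x) 1 f a ->
  is_derive x 1 (fun s => f (g s)) (a * b).
Proof. by move=> dg df; exact: is_derive1_comp. Qed.

Lemma der_sinM {a x} : is_derive x 1 (fun s => sin (a * s)) (a * cos (a * x)).
Proof.
apply: is_derive_eq (der_comp (derZ der_id) (is_derive_sin _)) _.
by rewrite mulr1 mulrC.
Qed.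

Lemma der_cosM {a x} : is_derive x 1 (fun s => cos (a * s)) (- (a * sin (a * x))).
Proof.
apply: is_derive_eq (der_comp (derZ der_id) (is_derive_cos _)) _.
by rewrite mulr1 mulNr mulrC.
Qed.

Lemma der_sum {n} {F : 'I_n -> R -> R} {dF : 'I_n -> R} {x} :
  (forall i, is_derive x 1 (F i) (dF i)) ->
  is_derive x 1 (fun s => \sum_(i < n) F i s) (\sum_(i < n) dF i).
Proof.
move=> dFi; have := is_derive_sum dFi.
by rewrite (_ : \sum_(i < n) F i = fun s => \sum_(i < n) F i s)//;
  apply/funext => s; rewrite fct_sumE.
Qed.

Lemma le_of_der_ge0 (f df : R -> R) a b : a <= b ->
  (forall x, a <= x <= b -> is_derive x 1 f (df x)) ->
  (forall x, a <= x <= b -> 0 <= df x) -> f a <= f b.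
Proof.
move=> ab fd df0; rewrite -subr_ge0.
have [||c + ->] := MVT_segment ab (f := f) (df := df).
- by move=> x /andP[/ltW ax /ltW xb]; apply: fd; rewrite ax.
- apply: continuous_in_subspaceT => x; rewrite inE /= in_itv /= => /fd.
  by case=> /derivable1_diffP /differentiable_continuous.
- by rewrite in_itv /= => /df0 d0; rewrite mulr_ge0// subr_ge0.
Qed.

Lemma eq_increment {f g df : R -> R} {a b : R} : a <= b ->
  (forall x, a <= x <= b -> is_derive x 1 f (df x)) ->
  (forall x, a <= x <= b -> is_derive x 1 g (df x)) -> f b - f a = g b - g a.
Proof.
move=> ab fd gd.
have mono (h : R -> R) : (forall x, a <= x <= b -> is_derive x 1 h 0) -> h a <= h b.
  by move=> hd; apply: (@le_of_der_ge0 h (fun=> 0)).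
have H1 : f a - g a <= f b - g b.
  apply: (mono (fun s => f s - g s)) => x xab.
  exact: is_derive_eq (derB (fd x xab) (gd x xab)) (subrr _).
have H2 : g a - f a <= g b - f b.
  apply: (mono (fun s => g s - f s)) => x xab.
  exact: is_derive_eq (derB (gd x xab) (fd x xab)) (subrr _).
lra.
Qed.

End Derivatives.

(** * The functions sinc and kap *)

Section Trigonometry.
Context {R : realType}.
Implicit Types (x y u : R).

Lemma ler_norm_sin u : `|sin u| <= `|u|.
Proof.
wlog u0 : u / 0 <= u => [H|].
  by have [/H//|/ltW] := leP 0 u; rewrite -oppr_ge0 => /H; rewrite sinN !normrN.
have := @le_of_der_ge0 _ (fun s : R => s - sin s) _ 0 u u0
  (fun x _ => derB der_id (is_derive_sin x)).
have := @le_of_der_ge0 _ (fun s : R => s + sin s) _ 0 u u0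
  (fun x _ => derD der_id (is_derive_sin x)).
rewrite sin0 (ger0_norm u0) ler_norml => H1 H2.
have {}H1 := H1 (fun x _ => ltac:(have := cos_geN1 x; lra)).
have {}H2 := H2 (fun x _ => ltac:(have := cos_le1 x; lra)).
lra.
Qed.

Lemma sin_half u : sin u = 2 * sin (u / 2) * cos (u / 2).
Proof. by rewrite [in LHS](splitr u) sinD; ring. Qed.

Lemma cos_half u : 1 - cos u = 2 * sin (u / 2) ^+ 2.
Proof.
rewrite [X in cos X](splitr u) cosD; have := cos2Dsin2 (u / 2); lra.
Qed.

(** Doubling the angle in [|sin (u / 2)| <= |u / 2|] leaves the factor
    [|cos (u / 2)|] to spare. *)
Lemma norm_sin_eq u : `|sin u| = `|u| -> u = 0.
Proof.
move=> su; apply/eqP; rewrite -normr_eq0 -su normr_eq0; apply/eqP.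
have: `|u| * 1 <= `|u| * `|cos (u / 2)|.
  rewrite mulr1 -[leLHS]su sin_half !normrM ler_wpM2r//.
  have := ler_norm_sin (u / 2); rewrite normrM [`|2^-1|]ger0_norm//.
  by rewrite (ger0_norm (ler0n R 2)); lra.
have [->|u0] := eqVneq u 0; first by rewrite sin0.
rewrite ler_pM2l ?normr_gt0// => c1.
have /cos1sin0 s0 : `|cos (u / 2)| = 1 by apply/eqP; rewrite eq_le cos_max.
by rewrite sin_half s0 mulr0 mul0r.
Qed.

Lemma one_sub_cos_le u : 0 <= 1 - cos u <= u ^+ 2.
Proof.
rewrite cos_half; have := ler_norm_sin (u / 2).
rewrite -ler_sqr ?nnegrE// !real_normK ?num_real// => H.
have -> : u ^+ 2 = 4 * (u / 2) ^+ 2 by field.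
have := sqr_ge0 (sin (u / 2)); lra.
Qed.

(** The bound is cruder than the optimal one, but any power of [u] beyond the
    square makes [kap] continuous at [0]. *)
Lemma norm_sub_sin_le u : `|u - sin u| <= `|u| ^+ 3.
Proof.
wlog u0 : u / 0 <= u => [H|].
  have [/H//|/ltW] := leP 0 u; rewrite -oppr_ge0 => /H.
  by rewrite sinN -opprB !normrN opprK addrC.
have := @le_of_der_ge0 _ (fun s : R => s - sin s) _ 0 u u0
  (fun x _ => derB der_id (is_derive_sin x)).
have := @le_of_der_ge0 _ (fun s : R => s ^+ 3 - (s - sin s)) _ 0 u u0
  (fun x _ => derB (derX der_id) (derB der_id (is_derive_sin x))).
rewrite sin0 (ger0_norm u0) => H1 H2.
have {}H1 := H1 (fun x _ => ltac:(have := one_sub_cos_le x;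
 have := sqr_ge0 x; lra)).
have {}H2 := H2 (fun x _ => ltac:(have := cos_le1 x; lra)).
rewrite ler_norml; rewrite /= expr0n /= in H1; lra.
Qed.

Definition sinc x := if x == 0 then 1 else sin x / x.

(** [kap x] is [(x - sin x cos x) / x ^ 2], extended by continuity at [0]. *)
Definition kap x := (1 - sinc x * cos x) / x.

Lemma sinc0 : sinc 0 = 1. Proof. by rewrite /sinc eqxx. Qed.
Lemma kap0 : kap 0 = 0. Proof. by rewrite /kap invr0 mulr0. Qed.

Lemma sincN x : sinc (- x) = sinc x.
Proof. by rewrite /sinc oppr_eq0 sinN invrN mulrNN. Qed.

Lemma kapN x : kap (- x) = - kap x.
Proof. by rewrite /kap sincN cosN invrN mulrN. Qed.

Lemma mul_sinc x : x * sinc x = sin x.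
Proof.
rewrite /sinc; have [->|x0] := eqVneq x 0; first by rewrite sin0 mul0r.
by rewrite mulrCA divff// mulr1.
Qed.

Lemma mul_kap x : x ^+ 2 * kap x = x - sin x * cos x.
Proof.
have [->|x0] := eqVneq x 0; first by rewrite sin0 !mul0r expr0n mul0r subr0.
by rewrite /kap -mul_sinc; field.
Qed.

Lemma sinc_dist1 x : `|1 - sinc x| <= x ^+ 2.
Proof.
have [->|x0] := eqVneq x 0; first by rewrite sinc0 subrr normr0 sqr_ge0.
rewrite -(ler_pM2l (_ : 0 < `|x|)) ?normr_gt0// -normrM mulrBr mulr1 mul_sinc.
by rewrite -(real_normK (num_real x)) -exprS norm_sub_sin_le.
Qed.

Lemma sinc_sqr_le1 x : sinc x ^+ 2 <= 1.
Proof.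
have [->|x0] := eqVneq x 0; first by rewrite sinc0 expr1n.
have := ler_norm_sin x; rewrite -mul_sinc normrM -[leRHS]mulr1.
by rewrite ler_pM2l ?normr_gt0// -(real_normK (num_real _)) expr_le1.
Qed.

Lemma norm_kap_le x : `|kap x| <= 2 * `|x|.
Proof.
have [->|x0] := eqVneq x 0; first by rewrite kap0 normr0 mulr0.
rewrite -(ler_pM2l (_ : 0 < `|x|)) ?normr_gt0// -normrM.
have -> : x * kap x = (1 - cos x) + cos x * (1 - sinc x) by rewrite /kap; field.
rewrite mulrCA -expr2 real_normK ?num_real//.
apply: (le_trans (ler_normD _ _)); rewrite mulr_natl mulr2n lerD//.
  by have /andP[? ?] := one_sub_cos_le x; rewrite ger0_norm.
rewrite normrM -[leRHS]mul1r ler_pM//; [exact: cos_max|exact: sinc_dist1].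
Qed.

Lemma continuous_of_dist_le (f g : R -> R) x :
  (forall y, `|f y - f x| <= g y) -> g x = 0 -> {for x, continuous g} ->
  {for x, continuous f}.
Proof.
move=> fg gx0 gx; apply/subr_cvg0; apply/norm_cvg0P.
apply: (squeeze_cvgr _ (cvg_cst 0)); last first.
  by rewrite -[0 in X in _ --> X]gx0; exact: gx.
by near=> y; rewrite normr_ge0 fg.
Unshelve. all: by end_near. Qed.

Lemma continuous_sinc : continuous sinc.
Proof.
move=> x; have [->|x0] := eqVneq x 0.
  apply: (@continuous_of_dist_le _ (fun y => y ^+ 2)).
  - by move=> y; rewrite sinc0 distrC sinc_dist1.
  - by rewrite expr0n.
  - exact: exprn_continuous.
have cx : {for x, continuous (fun y : R => sin y / y)}.
  by apply: cvgM; [exact: continuous_sin|exact: cvgV].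
rewrite /prop_for /continuous_at {2}/sinc (negPf x0).
apply: cvg_trans cx; apply: near_eq_cvg; near=> y; rewrite /sinc ifN//.
by near: y; exact: (cvgr_neq0 x).
Unshelve. all: by end_near. Qed.

Lemma continuous_kap : continuous kap.
Proof.
move=> x; have [->|x0] := eqVneq x 0.
  apply: (@continuous_of_dist_le _ (fun y => 2 * `|y|)).
  - by move=> y; rewrite kap0 subr0 norm_kap_le.
  - by rewrite normr0 mulr0.
  - by apply: cvgM; [exact: cvg_cst|exact: norm_continuous].
apply: cvgM; last exact: cvgV.
apply: cvgB; first exact: cvg_cst.
by apply: cvgM; [exact: continuous_sinc|exact: continuous_cos].
Qed.

(** If [sin x = c x] and [sin y = e c y] with a sign [e], equality of the
    values of [kap] reads [y - x = e sin (y - x)], which forces [x = y]. *)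
Lemma sinc_kap_inj x y : sinc x ^+ 2 = sinc y ^+ 2 -> kap x = kap y -> x = y.
Proof.
have at0 z : 1 = sinc z ^+ 2 -> z = 0.
  move=> s1; apply: norm_sin_eq; rewrite -mul_sinc normrM.
  have /eqP -> : `|sinc z| == 1 by rewrite -sqr_norm_eq1 -s1.
  by rewrite mulr1.
have [->|x0] := eqVneq x 0; first by rewrite sinc0 expr1n => /at0.
have [->|y0] := eqVneq y 0; first by rewrite sinc0 expr1n => /esym/at0.
move=> ss kk; apply/esym/eqP; rewrite -subr_eq0; apply/eqP/norm_sin_eq.
have E : y * (1 - sinc x * cos x) = x * (1 - sinc y * cos y).
  have : x * y * kap x = x * y * kap y by rewrite kk.
  by rewrite /kap => /eqP; rewrite -subr_eq0 => /eqP H; apply/eqP;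
     rewrite -subr_eq0 -[X in _ == X]H; apply/eqP; field; rewrite x0 y0.
rewrite sinB -!mul_sinc.
move/eqP: ss; rewrite eqf_sqr => /orP[] /eqP ss.
  congr `|_|; rewrite ss in E *; lra.
rewrite -[RHS]normrN; congr `|_|; rewrite ss in E *; lra.
Qed.

Lemma sinc_kap_gt0 x : 0 < sinc x ^+ 2 + `|kap x|.
Proof.
have [s0|s0] := eqVneq (sinc x) 0; last first.
  by rewrite ltr_pwDl// lt_def sqr_ge0 sqrf_eq0 s0.
rewrite s0 expr0n add0r normr_gt0 /kap s0 mul0r subr0 mul1r invr_eq0.
by apply/eqP => x0; move/eqP: s0; rewrite x0 sinc0 oner_eq0.
Qed.

End Trigonometry.

(** * The end point equations *)

Section Endpoint.
Context {R : realType}.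
Implicit Types (N tau x L : R).

(** [x] is half of the angle by which the velocity of a geodesic of length [L]
    turns before reaching a point at squared horizontal distance [N] and height
    [tau]; up to one full turn the geodesic is minimizing. *)
Definition endpoint N tau x L : Prop :=
  [/\ 0 < L, `|x| <= pi, N = L ^+ 2 * sinc x ^+ 2 & 2 * tau = L ^+ 2 * kap x].

Lemma endpointN {N tau x L} : endpoint N tau x L -> endpoint N (- tau) (- x) L.
Proof. by case=> L0 xpi -> t; split; rewrite ?normrN ?sincN ?kapN ?mulrN ?t. Qed.

Lemma kap_ge0 x : 0 <= x -> 0 <= kap x.
Proof.
move=> x0; have [->|xn0] := eqVneq x 0; first by rewrite kap0.
rewrite -(pmulr_rge0 _ (_ : 0 < x ^+ 2)) ?mul_kap ?exprn_even_gt0//.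
have := ler_norm_sin (x + x);
  rewrite sinD (ger0_norm (addr_ge0 x0 x0)).
move/(le_trans (ler_norm _)); lra.
Qed.

(** For [0 <= tau], the equations prescribe the direction of
    [(sinc x ^ 2, kap x)] in the first quadrant, and this direction sweeps the
    quadrant as [x] runs over [[0, pi]]. The length is then a normalizing
    factor. *)
Lemma endpoint_exists N tau : 0 <= N -> (N != 0) || (tau != 0) ->
  exists x L, endpoint N tau x L.
Proof.
move=> N0; wlog t0 : tau / 0 <= tau => [H|] nz.
  have [/H/(_ nz)//|/ltW t0] := leP 0 tau.
  have [|//|x [L /endpointN]] := H (- tau); first by rewrite oppr_ge0.
    by rewrite oppr_eq0.
  by rewrite opprK; exists (- x), L.
have [||x + /eqP] := @IVT R (fun x => N * kap x - 2 * tau * sinc x ^+ 2) 0 pi 0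
  (pi_ge0 R).
- apply: continuous_subspaceT => x; apply: cvgB.
    by apply: cvgM; [exact: cvg_cst|exact: continuous_kap].
  apply: cvgM; first exact: cvg_cst.
  by apply: cvgM; exact: continuous_sinc.
- have -> : sinc pi = 0 :> R by rewrite /sinc gt_eqF ?pi_gt0// sinpi mul0r.
  rewrite kap0 sinc0 mulr0 sub0r expr1n mulr1 expr0n mulr0 subr0.
  rewrite ge_min le_max oppr_le0 mulr_ge0//= orbC mulr_ge0//.
  exact: kap_ge0 (pi_ge0 R).
rewrite in_itv /= => /andP[x0 xpi]; rewrite subr_eq0 => /eqP E.
set s := sinc x ^+ 2 in E; set k := kap x in E.
have k0 : 0 <= k by exact: kap_ge0.
have s0 : 0 <= s by exact: sqr_ge0.
have D0 : 0 < s ^+ 2 + k ^+ 2.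
  have := sinc_kap_gt0 x; rewrite -/s -/k (ger0_norm k0) => /(exprn_gt0 2).
  have := sqr_ge0 (s - k); lra.
have M0 : 0 < N * s + 2 * tau * k.
  have : 0 <= N * s + 2 * tau * k by apply: addr_ge0; apply: mulr_ge0 => //; exact: mulr_ge0.
  rewrite le_eqVlt => /predU1P[/esym M|//].
  have : (N ^+ 2 + 4 * tau ^+ 2) * (s ^+ 2 + k ^+ 2) = 0.
    transitivity ((N * s + 2 * tau * k) ^+ 2 + (N * k - 2 * tau * s) ^+ 2).
      by ring.
    by rewrite M E subrr expr0n addr0.
  move=> /eqP; rewrite mulf_eq0 (gt_eqF D0) orbF => /eqP Z.
  have := sqr_ge0 N; have := sqr_ge0 tau => h1 h2.
  have /eqP : N ^+ 2 = 0 by lra.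
  have /eqP : tau ^+ 2 = 0 by lra.
  by rewrite !sqrf_eq0 => /eqP t00 /eqP N00; rewrite N00 t00 eqxx in nz.
(* [(N, 2 tau)] is parallel to [(s, k)] by [E]; the squared length is the
   ratio, read off from scalar products since [s] or [k] may vanish. *)
exists x, (Num.sqrt ((N * s + 2 * tau * k) / (s ^+ 2 + k ^+ 2))); split.
- by rewrite sqrtr_gt0 divr_gt0.
- by rewrite ger0_norm.
- rewrite sqr_sqrtr; last by rewrite ltW// divr_gt0.
  apply/esym; rewrite -/s mulrAC.
  have -> : (N * s + 2 * tau * k) * s = N * s ^+ 2 + (2 * tau * s) * k by ring.
  by rewrite -E; field; rewrite gt_eqF.
- rewrite sqr_sqrtr; last by rewrite ltW// divr_gt0.
  apply/esym; rewrite -/k mulrAC.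
  have -> : (N * s + 2 * tau * k) * k = (N * k) * s + 2 * tau * k ^+ 2 by ring.
  by rewrite E; field; rewrite gt_eqF.
Qed.

Lemma sinc_kap_lower_bound : exists2 m, 0 < m &
  forall x, `|x| <= pi -> m <= sinc x ^+ 2 + `|kap x|.
Proof.
have [||c _ H] := @EVT_min R (fun x => sinc x ^+ 2 + `|kap x|) (- pi) pi.
- by rewrite -subr_ge0 opprK addr_ge0// pi_ge0.
- apply: continuous_subspaceT => x; apply: cvgD.
    by apply: cvgM; exact: continuous_sinc.
  by apply: cvg_norm; exact: continuous_kap.
exists (sinc c ^+ 2 + `|kap c|); first exact: sinc_kap_gt0.
by move=> x xpi; apply: H; rewrite in_itv /= -ler_norml.
Qed.

Lemma endpoint_le {N tau x L} : endpoint N tau x L ->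
  N <= L ^+ 2 /\ `|tau| <= pi * L ^+ 2.
Proof.
case=> L0 xpi -> t; split.
  by rewrite -[leRHS]mulr1 ler_wpM2l ?sqr_ge0// sinc_sqr_le1.
rewrite -(ler_pM2l (_ : 0 < 2)) ?ltr0n// -[X in X * `|_|]normr_nat -normrM t.
rewrite normrM (ger0_norm (sqr_ge0 _)).
have kpi : `|kap x| <= 2 * pi.
  by apply: (le_trans (norm_kap_le x)); rewrite ler_wpM2l.
have := ler_wpM2l (sqr_ge0 L) kpi; lra.
Qed.

End Endpoint.

(** * A compactness criterion for convergence *)

Lemma ultra_fmap {T Y : Type} (f : T -> Y) (U : set_system T) :
  UltraFilter U -> UltraFilter (f @ U).
Proof.
move=> UU; split; first exact: fmap_proper_filter.
move=> G PG sUG; apply/seteqP; split=> A //; last exact: sUG.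
move=> GA; have [//|UnA] := in_ultra_setVsetC (f @^-1` A) UU.
have [y [Ay nAy]] : A `&` ~` A !=set0.
  by apply: (@filter_ex _ G); apply: filterI => //; exact: sUG.
by have := nAy Ay.
Qed.

(** Otherwise the image under [f] of some ultrafilter finer than [F] would stay
    away from [y0] while converging in [K]. *)
Lemma cvg_of_compact {T : Type} {Y : topologicalType} (F : set_system T)
    {FF : Filter F} (f : T -> Y) (K : set Y) (y0 : Y) :
  compact K -> F (f @^-1` K) ->
  (forall (G : set_system T), ProperFilter G -> F `<=` G ->
    forall y, f @ G --> y -> y = y0) ->
  f @ F --> y0.
Proof.
move=> cK FK H V /= Vy0; apply: contrapT => nFV.
pose W := ~` (f @^-1` V).
have PG : ProperFilter (within W F).
  split; last exact: within_filter.
  by move=> F0; apply: nFV; apply: (@filterS _ F _ _ _ _ F0) => x nW; apply: contrapT => /nW.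
have [U [UU sU]] := ultraFilterLemma PG.
have FU : F `<=` U by move=> A FA; apply: sU; apply: filterS FA => x Ax _.
have UW : U W by apply: sU; exact: withinT.
move: cK; rewrite compact_ultra => /(_ (f @ U) (ultra_fmap f U UU) (FU _ FK)) [y [_ fy]].
have E : y = y0 by apply: (H U _ FU).
have [x [Vx nVx]] : (f @^-1` V) `&` W !=set0.
  apply: (@filter_ex _ U); apply: filterI => //; apply: fy; by rewrite E.
exact: nVx.
Qed.

(** * Horizontal curves and left translations *)

Section Geometry.
Context {R : realType} {n : nat}.
Implicit Types (p q u v w : heis R n) (g h : R -> heis R n).

Definition hnorm2 v : R := \sum_(i < n) (xc i v ^+ 2 + yc i v ^+ 2).

(** The vector [v] with [p = q v] for the group law of which the fields
    [Xf i], [Yf i], [Tf] are left-invariant. *)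
Definition disp q p : heis R n :=
  ((p.1.1 - q.1.1, p.1.2 - q.1.2),
   tc p - tc q - \sum_(i < n) (yc i q * xc i p - xc i q * yc i p)).

Lemma heis_sumE (F : 'I_n -> heis R n) :
  \sum_(i < n) F i =
    ((\sum_(i < n) (F i).1.1, \sum_(i < n) (F i).1.2), \sum_(i < n) (F i).2).
Proof.
elim: (index_enum _) => [|i s IHs]; first by rewrite !big_nil.
by rewrite !big_cons IHs; case: (F i) => [[]].
Qed.

Lemma frame_sumE p (a b : 'I_n -> R) :
  \sum_(i < n) (a i *: Xf i p + b i *: Yf i p) =
  ((\row_i a i, \row_i b i), \sum_(i < n) (a i * yc i p - b i * xc i p)).
Proof.
rewrite heis_sumE; congr ((_, _), _) => /=.
- rewrite [RHS]row_sum_delta; apply: eq_bigr => i _.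
  by rewrite mxE scaler0 addr0.
- rewrite [RHS]row_sum_delta; apply: eq_bigr => i _.
  by rewrite mxE scaler0 add0r.
- by apply: eq_bigr => i _; rewrite /GRing.scale /= mulrN.
Qed.

Lemma horizontalP p v : horizontal p v <->
  tc v = \sum_(i < n) (yc i p * xc i v - xc i p * yc i v).
Proof.
split=> [[a [b ->]]|vt].
  rewrite frame_sumE /tc /=; apply: eq_bigr => i _.
  by rewrite /xc /yc /= !mxE; ring.
exists (fun i => xc i v), (fun i => yc i v).
rewrite [LHS](frameE p) /tcoef vt subrr scale0r addr0//.
Qed.

Lemma metric_horizontal p v : horizontal p v -> metric p v v = hnorm2 v.
Proof.
move=> /horizontalP vt; rewrite /metric /tcoef vt subrr mulr0 addr0.
by apply: eq_bigr => i _; rewrite !expr2.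
Qed.

Lemma hnorm2_ge0 v : 0 <= hnorm2 v.
Proof. by apply: sumr_ge0 => i _; rewrite addr_ge0 ?sqr_ge0. Qed.

Lemma mnorm_horizontal p v : horizontal p v -> mnorm p v ^+ 2 = hnorm2 v.
Proof.
by move=> hv; rewrite /mnorm metric_horizontal// sqr_sqrtr// hnorm2_ge0.
Qed.

Lemma is_derive_smooth (f : R -> R) (s : R) : smooth f -> is_derive s 1 f (derive1 f s).
Proof. by move=> /(_ 0%N s) fs; rewrite derive1E; exact: derivableP. Qed.

Lemma smooth_derive1 (f : R -> R) : smooth f -> smooth (derive1 f).
Proof. by move=> fs k s; rewrite -derive1Sn; exact: fs. Qed.

Lemma xc_disp q p i : xc i (disp q p) = xc i p - xc i q.
Proof. by rewrite /xc /disp /= !mxE. Qed.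

Lemma yc_disp q p i : yc i (disp q p) = yc i p - yc i q.
Proof. by rewrite /yc /disp /= !mxE. Qed.

Lemma tc_disp q p : tc (disp q p) =
  tc p - tc q - \sum_(i < n) (yc i q * xc i p - xc i q * yc i p).
Proof. by []. Qed.

Lemma xc_velocity g s i : xc i (velocity g s) = derive1 (xc i \o g) s.
Proof. by rewrite /xc /= mxE. Qed.

Lemma yc_velocity g s i : yc i (velocity g s) = derive1 (yc i \o g) s.
Proof. by rewrite /yc /= mxE. Qed.

Lemma der_xc {g} {s : R} i : smooth_curve g ->
  is_derive s 1 (xc i \o g) (xc i (velocity g s)).
Proof. by case=> /(_ i)[gx _] _; rewrite xc_velocity; exact: is_derive_smooth. Qed.

Lemma der_yc {g} {s : R} i : smooth_curve g ->
  is_derive s 1 (yc i \o g) (yc i (velocity g s)).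
Proof. by case=> /(_ i)[_ gy] _; rewrite yc_velocity; exact: is_derive_smooth. Qed.

Lemma der_tc {g} {s : R} : smooth_curve g ->
  is_derive s 1 (tc \o g) (tc (velocity g s)).
Proof. by case=> _ gt; exact: is_derive_smooth. Qed.

Lemma der_xc_disp {q g} {s : R} i : smooth_curve g ->
  is_derive s 1 (fun r => xc i (disp q (g r))) (xc i (velocity g s)).
Proof.
move=> sg; rewrite (_ : (fun _ => _) = fun r => xc i (g r) - xc i q); last first.
  by apply/funext => r; rewrite xc_disp.
exact: is_derive_eq (derB (der_xc i sg) der_cst) (subr0 _).
Qed.

Lemma der_yc_disp {q g} {s : R} i : smooth_curve g ->
  is_derive s 1 (fun r => yc i (disp q (g r))) (yc i (velocity g s)).
Proof.
move=> sg; rewrite (_ : (fun _ => _) = fun r => yc i (g r) - yc i q); last first.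
  by apply/funext => r; rewrite yc_disp.
exact: is_derive_eq (derB (der_yc i sg) der_cst) (subr0 _).
Qed.

(** Left-invariance: a horizontal curve remains horizontal after the translation
    taking [q] to the origin. *)
Lemma der_tc_disp {q g} {s : R} : smooth_curve g ->
  horizontal (g s) (velocity g s) ->
  is_derive s 1 (fun r => tc (disp q (g r)))
    (\sum_(i < n) (yc i (disp q (g s)) * xc i (velocity g s) -
                   xc i (disp q (g s)) * yc i (velocity g s))).
Proof.
move=> sg /horizontalP hv; rewrite (_ : (fun _ => _) = fun r => tc (g r) - tc q -
    \sum_(i < n) (yc i q * xc i (g r) - xc i q * yc i (g r)))//.
apply: is_derive_eq.
  apply: (derB (derB (der_tc sg) der_cst)); apply: der_sum => i.
  exact: derB (derZ (der_xc i sg)) (derZ (der_yc i sg)).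
rewrite subr0 hv -sumrB; apply: eq_bigr => i _; rewrite xc_disp yc_disp; ring.
Qed.

End Geometry.

(** * End points of geodesics *)

Section Geodesics.
Context {R : realType} {n : nat}.
Implicit Types (p q u v w : heis R n) (g h : R -> heis R n) (lam L s : R).

Lemma Jmap_frame p v :
  Jmap p v = \sum_(i < n) ((- yc i v) *: Xf i p + xc i v *: Yf i p).
Proof. by apply: eq_bigr => i _; rewrite addrC scaleNr. Qed.

Lemma geodesic_eqP lam g s : (covderiv g (velocity g) s +
    lam *: Jmap (g s) (velocity g s) = 0) <->
  [/\ forall i, derive1 (xc i \o velocity g) s = lam * yc i (velocity g s),
      forall i, derive1 (yc i \o velocity g) s = - (lam * xc i (velocity g s)) &
      derive1 (fun r => tcoef (g r) (velocity g r)) s = 0].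
Proof.
rewrite /covderiv Jmap_frame !frame_sumE; split=> [E|[Ex Ey ->]]; last first.
  rewrite scale0r addr0; congr ((_, _), _).
  - by apply/rowP => i; rewrite !mxE Ex; ring.
  - by apply/rowP => i; rewrite !mxE Ey; ring.
  - rewrite /= scaler_sumr -big_split big1// => i _ /=.
    by rewrite Ex Ey /GRing.scale /=; ring.
have E1 i := congr1 (fun w : heis R n => w.1.1 0 i) E.
have E2 i := congr1 (fun w : heis R n => w.1.2 0 i) E.
have E3 := congr1 (fun w : heis R n => w.2) E.
have Ex i : derive1 (xc i \o velocity g) s = lam * yc i (velocity g s).
  by have := E1 i; rewrite /= !mxE => /eqP; lra.
have Ey i : derive1 (yc i \o velocity g) s = - (lam * xc i (velocity g s)).
  by have := E2 i; rewrite /= !mxE => /eqP; lra.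
split=> //; move: E3; rewrite /= scaler_sumr -addrA addrCA -big_split big1.
  by rewrite addr0 /GRing.scale /= mulr1.
by move=> i _ /=; rewrite Ex Ey /GRing.scale /=; ring.
Qed.

Section OneGeodesic.
Context {lam L : R} {g : R -> heis R n}.
Hypotheses (L0 : 0 < L) (gg : geodesic lam L g).
Let a i := xc i (velocity g 0).
Let b i := yc i (velocity g 0).

Let sg : smooth_curve g. Proof. by case: gg. Qed.

Let der_vx s i : 0 <= s <= L ->
  is_derive s 1 (fun r => xc i (velocity g r)) (lam * yc i (velocity g s)).
Proof.
move=> sL; have [_ /(_ s)] := gg; rewrite in_itv /= => /(_ sL)[_ _].
move=> /geodesic_eqP[/(_ i) <- _ _].
rewrite (_ : xc i \o _ = derive1 (xc i \o g)); last first.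
  by apply/funext => r /=; rewrite xc_velocity.
rewrite (_ : (fun _ => _) = derive1 (xc i \o g)); last first.
  by apply/funext => r /=; rewrite xc_velocity.
exact/is_derive_smooth/smooth_derive1/(sg.1 i).1.
Qed.

Let der_vy s i : 0 <= s <= L ->
  is_derive s 1 (fun r => yc i (velocity g r)) (- (lam * xc i (velocity g s))).
Proof.
move=> sL; have [_ /(_ s)] := gg; rewrite in_itv /= => /(_ sL)[_ _].
move=> /geodesic_eqP[_ /(_ i) <- _].
rewrite (_ : yc i \o _ = derive1 (yc i \o g)); last first.
  by apply/funext => r /=; rewrite yc_velocity.
rewrite (_ : (fun _ => _) = derive1 (yc i \o g)); last first.
  by apply/funext => r /=; rewrite yc_velocity.
exact/is_derive_smooth/smooth_derive1/(sg.1 i).2.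
Qed.

Let hor s : 0 <= s <= L -> horizontal (g s) (velocity g s).
Proof. by move=> sL; have [_ /(_ s)] := gg; rewrite in_itv => /(_ sL)[]. Qed.

Let unit_speed : \sum_(i < n) (a i ^+ 2 + b i ^+ 2) = 1.
Proof.
have L00 : 0 <= (0 : R) <= L by apply/andP; split=> //; exact: ltW.
have [_ /(_ 0)] := gg; rewrite in_itv => /(_ L00)[+ + _].
by move=> /mnorm_horizontal H m1; rewrite -[LHS]/(hnorm2 (velocity g 0)) -H m1 expr1n.
Qed.

(** The velocity, rotated back by the angle [lam s], has zero derivative. *)
Let velocityE s i : 0 <= s <= L ->
  xc i (velocity g s) = cos (lam * s) * a i + sin (lam * s) * b i /\
  yc i (velocity g s) = cos (lam * s) * b i - sin (lam * s) * a i.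
Proof.
move=> /andP[s0 sL].
have in0L r : 0 <= r <= s -> 0 <= r <= L.
  by move=> /andP[-> /le_trans]; exact.
have E1 : cos (lam * s) * xc i (velocity g s)
        - sin (lam * s) * yc i (velocity g s) = a i.
  have := @eq_increment _ (fun r => cos (lam * r) * xc i (velocity g r) -
    sin (lam * r) * yc i (velocity g r)) (fun=> 0) (fun=> 0) 0 s s0.
  rewrite mulr0 cos0 sin0 mul0r subr0 mul1r subrr => H; apply/subr0_eq/H.
  - move=> r /in0L rL; apply: is_derive_eq.
      by apply: derB; [exact: derM der_cosM (der_vx r i rL)|
                      exact: derM der_sinM (der_vy r i rL)].
    by rewrite /=; ring.
have E2 : sin (lam * s) * xc i (velocity g s)
        + cos (lam * s) * yc i (velocity g s) = b i.
  have := @eq_increment _ (fun r => sin (lam * r) * xc i (velocity g r) +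
    cos (lam * r) * yc i (velocity g r)) (fun=> 0) (fun=> 0) 0 s s0.
  rewrite mulr0 cos0 sin0 mul0r add0r mul1r subrr => H; apply/subr0_eq/H.
  - move=> r /in0L rL; apply: is_derive_eq.
      by apply: derD; [exact: derM der_sinM (der_vx r i rL)|
                      exact: derM der_cosM (der_vy r i rL)].
    by rewrite /=; ring.
have C := cos2Dsin2 (lam * s).
split; rewrite -E1 -E2.
  by rewrite -[LHS]mul1r -C; ring.
by rewrite -[LHS]mul1r -C; ring.
Qed.

Let dispE s i : 0 <= s <= L ->
  lam * xc i (disp (g 0) (g s)) = b i - yc i (velocity g s) /\
  lam * yc i (disp (g 0) (g s)) = xc i (velocity g s) - a i.
Proof.
move=> /andP[s0 sL].
have in0L r : 0 <= r <= s -> 0 <= r <= L.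
  by move=> /andP[-> /le_trans]; exact.
have dx r : 0 <= r <= s ->
    is_derive r 1 (fun r => b i - yc i (velocity g r)) (lam * xc i (velocity g r)).
  move=> /in0L rL; apply: is_derive_eq (derB der_cst (der_vy r i rL)) _.
  by rewrite sub0r opprK.
have dy r : 0 <= r <= s ->
    is_derive r 1 (fun r => xc i (velocity g r) - a i) (lam * yc i (velocity g r)).
  move=> /in0L rL; apply: is_derive_eq (derB (der_vx r i rL) der_cst) _.
  by rewrite subr0.
have := eq_increment s0 (fun r _ => derZ (der_xc_disp (q := g 0) i sg)) dx.
have := eq_increment s0 (fun r _ => derZ (der_yc_disp (q := g 0) i sg)) dy.
cbv beta; rewrite (xc_disp (g 0) (g 0)) (yc_disp (g 0) (g 0)) !subrr mulr0 !subr0.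
by move=> -> ->.
Qed.

Let dispE0 s i : lam = 0 -> 0 <= s <= L ->
  xc i (disp (g 0) (g s)) = s * a i /\ yc i (disp (g 0) (g s)) = s * b i.
Proof.
move=> lam0 /andP[s0 sL].
have V r : 0 <= r <= s -> xc i (velocity g r) = a i /\ yc i (velocity g r) = b i.
  move=> /andP[r0 rs]; have [|-> ->] := @velocityE r i.
    by rewrite r0 (le_trans rs).
  by rewrite lam0 mul0r cos0 sin0; split; ring.
have dM c r : 0 <= r <= s -> is_derive r 1 (fun r : R => r * c) c.
  move=> _; apply: is_derive_eq (derM der_id der_cst) _.
  by rewrite mulr0 add0r mulr1.
have dx r : 0 <= r <= s ->
    is_derive r 1 (fun r => xc i (disp (g 0) (g r))) (a i).
  by move=> /V[<- _]; exact: der_xc_disp.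
have dy r : 0 <= r <= s ->
    is_derive r 1 (fun r => yc i (disp (g 0) (g r))) (b i).
  by move=> /V[_ <-]; exact: der_yc_disp.
have := eq_increment s0 dx (dM _); have := eq_increment s0 dy (dM _).
cbv beta; rewrite (xc_disp (g 0) (g 0)) (yc_disp (g 0) (g 0)) !subrr !mul0r !subr0.
by move=> -> ->.
Qed.

(** Integrating [x'' = lam y'] and [y'' = - lam x'] once gives the horizontal
    displacement, hence the vertical velocity. *)
Lemma geodesic_endpoint (x := lam * L / 2) :
  hnorm2 (disp (g 0) (g L)) = L ^+ 2 * sinc x ^+ 2 /\
  2 * tc (disp (g 0) (g L)) = L ^+ 2 * kap x.
Proof.
have LL : 0 <= L <= L by apply/andP; split=> //; exact: ltW.
have tc00 : tc (disp (g 0) (g 0)) = 0.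
  by rewrite tc_disp subrr sub0r big1 ?oppr0// => i _; rewrite mulrC subrr.
have [lam0|lam0] := eqVneq lam 0.
  have -> : x = 0 by rewrite /x lam0 !mul0r.
  rewrite sinc0 kap0 expr1n mulr1 mulr0; split.
    rewrite -[RHS]mulr1 -unit_speed mulr_sumr; apply: eq_bigr => i _.
    by have [-> ->] := dispE0 L i lam0 LL; rewrite !exprMn mulrDr.
  have dt r : 0 <= r <= L -> is_derive r 1 (fun r => tc (disp (g 0) (g r))) 0.
    move=> rL; apply: is_derive_eq (der_tc_disp sg (hor r rL)) _.
    apply: big1 => i _; have [-> ->] := dispE0 r i lam0 rL.
    have [-> ->] := velocityE r i rL.
    by rewrite lam0 mul0r cos0 sin0; ring.
  have := eq_increment (ltW L0) dt (fun r _ => der_cst (a := 0)).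
  by cbv beta; rewrite tc00 !subr0 => ->; rewrite mulr0.
have xE : 2 * x = lam * L by rewrite /x; field.
have l2 : lam ^+ 2 != 0 by rewrite sqrf_eq0.
split; apply: (mulfI l2).
  have -> : lam ^+ 2 * (L ^+ 2 * sinc x ^+ 2) = (2 * sin x) ^+ 2.
    by rewrite -mul_sinc (mulrA 2) xE; ring.
  transitivity (2 * (1 - cos (lam * L)) * \sum_(i < n) (a i ^+ 2 + b i ^+ 2)).
    rewrite /hnorm2 !mulr_sumr; apply: eq_bigr => i _.
    rewrite mulrDr -!exprMn; have [-> ->] := dispE L i LL.
    have [-> ->] := velocityE L i LL; have S2 := sin2cos2 (lam * L).
    set C := cos _ in S2 *; set S := sin _ in S2 *.
    have -> : (b i - (C * b i - S * a i)) ^+ 2 + (C * a i + S * b i - a i) ^+ 2 =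
      (S ^+ 2 + (1 - C) ^+ 2) * (a i ^+ 2 + b i ^+ 2) by ring.
    by rewrite S2; ring.
  by rewrite unit_speed cos_half -/x; ring.
have dt r : 0 <= r <= L -> is_derive r 1 (fun r => lam * tc (disp (g 0) (g r)))
    (1 - cos (lam * r)).
  move=> rL; apply: is_derive_eq (derZ (der_tc_disp sg (hor r rL))) _.
  transitivity ((1 - cos (lam * r)) * \sum_(i < n) (a i ^+ 2 + b i ^+ 2)).
    rewrite !mulr_sumr; apply: eq_bigr => i _.
    rewrite mulrBr !mulrA; have [-> ->] := dispE r i rL.
    have [-> ->] := velocityE r i rL; have S2 := sin2cos2 (lam * r).
    set C := cos _ in S2 *; set S := sin _ in S2 *.
    have -> : (C * a i + S * b i - a i) * (C * a i + S * b i) -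
      (b i - (C * b i - S * a i)) * (C * b i - S * a i) =
      (S ^+ 2 + C ^+ 2 - C) * (a i ^+ 2 + b i ^+ 2) by ring.
    by rewrite S2; ring.
  by rewrite unit_speed mulr1.
have ds r : 0 <= r <= L -> is_derive r 1 (fun r => r - lam^-1 * sin (lam * r))
    (1 - cos (lam * r)).
  move=> _; apply: is_derive_eq (derB der_id (derZ der_sinM)) _.
  by rewrite mulrA mulVf// mul1r.
have := eq_increment (ltW L0) dt ds.
cbv beta; rewrite tc00 !mulr0 sin0 mulr0 !subr0 => E.
have -> : lam ^+ 2 * (L ^+ 2 * kap x) = 4 * (x - sin x * cos x).
  rewrite -mul_kap; transitivity ((lam * L) ^+ 2 * kap x); first by ring.
  by rewrite -xE; ring.
transitivity (2 * lam * (lam * tc (disp (g 0) (g L)))); first by ring.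
have {}E : lam * tc (disp (g 0) (g L)) =
    L - lam^-1 * (2 * sin x * cos x) by rewrite E [in RHS]/x -sin_half.
rewrite E mulrBr mulrA; transitivity (2 * (lam * L) - 4 * sin x * cos x).
  by field.
by rewrite -xE; ring.
Qed.

End OneGeodesic.
End Geodesics.

(** * Geodesics with prescribed end points *)

Lemma derive1_eq {R : realType} {f df : R -> R} :
  (forall s : R, is_derive s 1 f (df s)) -> derive1 f = df.
Proof.
by move=> fd; apply/funext => s; rewrite derive1E; have [_ <-] := fd s.
Qed.

Section ExplicitGeodesics.
Context {R : realType} {n : nat}.
Implicit Types (p q u v w : heis R n) (g h : R -> heis R n) (lam L s : R).

(** Closed under differentiation, hence a class of smooth functions. *)
Definition trig lam (c0 c1 c2 c3 s : R) : R :=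
  c0 + c1 * s + c2 * sin (lam * s) + c3 * cos (lam * s).

Lemma der_trig lam c0 c1 c2 c3 s : is_derive s 1 (trig lam c0 c1 c2 c3)
  (trig lam c1 0 (- (lam * c3)) (lam * c2) s).
Proof.
apply: is_derive_eq (derD (derD (derD der_cst (derZ der_id)) (derZ der_sinM))
  (derZ der_cosM)) _.
by rewrite /trig; ring.
Qed.

Lemma smooth_trig lam c0 c1 c2 c3 : smooth (trig lam c0 c1 c2 c3).
Proof.
move=> k s; elim: k c0 c1 c2 c3 => [|k IHk] c0 c1 c2 c3.
  by rewrite derive1n0; have [] := der_trig lam c0 c1 c2 c3 s.
by rewrite derive1Sn (derive1_eq (der_trig lam c0 c1 c2 c3)).
Qed.

Section Curve.
Variables (lam : R) (q : heis R n) (a b : 'I_n -> R).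

(** The antiderivative of [cos (lam s)] vanishing at [0]; as [0^-1 = 0], the first
    term takes over when [lam = 0]. *)
Definition int_cos s : R := (lam == 0)%:R * s + lam^-1 * sin (lam * s).

(** The antiderivative of [sin (lam s)] vanishing at [0], also for [lam = 0]. *)
Definition int_sin s : R := lam^-1 * (1 - cos (lam * s)).

(** The geodesic of curvature [lam] issued from [q] whose initial velocity has
    coefficients [a] and [b] in the horizontal frame. *)
Definition geod s : heis R n :=
  ((\row_i (xc i q + (int_cos s * a i + int_sin s * b i)),
    \row_i (yc i q + (int_cos s * b i - int_sin s * a i))),
   tc q + \sum_(i < n) (yc i q * (int_cos s * a i + int_sin s * b i) -
                        xc i q * (int_cos s * b i - int_sin s * a i)) +
   lam^-1 * (s - lam^-1 * sin (lam * s))).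

Lemma xc_geod s i : xc i (geod s) = xc i q + (int_cos s * a i + int_sin s * b i).
Proof. by rewrite /xc /= mxE. Qed.

Lemma yc_geod s i : yc i (geod s) = yc i q + (int_cos s * b i - int_sin s * a i).
Proof. by rewrite /yc /= mxE. Qed.

Lemma geod0 : geod 0 = q.
Proof.
have c0 : int_cos 0 = 0 by rewrite /int_cos !mulr0 sin0 mulr0 addr0.
have s0 : int_sin 0 = 0 by rewrite /int_sin mulr0 cos0 subrr mulr0.
rewrite /geod c0 s0 mulr0 sin0 mulr0 subrr mulr0 addr0 big1 => [|i _].
  rewrite addr0; case: q => [[x y] t]; congr ((_, _), _).
  - by apply/rowP => i; rewrite mxE !mul0r !addr0.
  - by apply/rowP => i; rewrite mxE !mul0r subrr addr0.
by rewrite !mul0r addr0 subrr !mulr0 subrr.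
Qed.

Lemma smooth_geod : smooth_curve geod.
Proof.
split=> [i|]; first split.
- rewrite (_ : _ \o _ = trig lam (xc i q + lam^-1 * b i) ((lam == 0)%:R * a i)
    (lam^-1 * a i) (- (lam^-1 * b i))); first exact: smooth_trig.
  by apply/funext => s; rewrite /= xc_geod /trig /int_cos /int_sin; ring.
- rewrite (_ : _ \o _ = trig lam (yc i q - lam^-1 * a i) ((lam == 0)%:R * b i)
    (lam^-1 * b i) (lam^-1 * a i)); first exact: smooth_trig.
  by apply/funext => s; rewrite /= yc_geod /trig /int_cos /int_sin; ring.
pose A := \sum_(i < n) (yc i q * a i - xc i q * b i).
pose B := \sum_(i < n) (yc i q * b i + xc i q * a i).
rewrite (_ : _ \o _ = trig lam (tc q + lam^-1 * B) ((lam == 0)%:R * A + lam^-1)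
    (lam^-1 * A - lam^-1 * lam^-1) (- (lam^-1 * B))); first exact: smooth_trig.
apply/funext => s; rewrite /= {1}/tc /geod /=.
rewrite (_ : \sum_(i < n) _ = int_cos s * A + int_sin s * B).
  by rewrite /trig /int_cos /int_sin; ring.
by rewrite !mulr_sumr -big_split; apply: eq_bigr => i _ /=; ring.
Qed.

Lemma der_int_cos s : is_derive s 1 int_cos (cos (lam * s)).
Proof.
apply: is_derive_eq (derD (derZ der_id) (derZ der_sinM)) _.
rewrite mulrA mulr1; have [->|l0] := eqVneq lam 0.
  by rewrite mul0r cos0 mulr0 mul0r addr0.
by rewrite mulVf// mul1r add0r.
Qed.

Lemma der_int_sin s : is_derive s 1 int_sin (sin (lam * s)).
Proof.
apply: is_derive_eq (derZ (derB der_cst der_cosM)) _.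
rewrite sub0r opprK mulrA; have [->|l0] := eqVneq lam 0.
  by rewrite mul0r sin0 mulr0.
by rewrite mulVf// mul1r.
Qed.

Let vx i s : R := cos (lam * s) * a i + sin (lam * s) * b i.
Let vy i s : R := cos (lam * s) * b i - sin (lam * s) * a i.

Lemma der_X i s :
  is_derive s 1 (fun s => int_cos s * a i + int_sin s * b i) (vx i s).
Proof.
apply: is_derive_eq
  (derD (derM (der_int_cos s) der_cst) (derM (der_int_sin s) der_cst)) _.
by rewrite /vx; ring.
Qed.

Lemma der_Y i s :
  is_derive s 1 (fun s => int_cos s * b i - int_sin s * a i) (vy i s).
Proof.
apply: is_derive_eq
  (derB (derM (der_int_cos s) der_cst) (derM (der_int_sin s) der_cst)) _.
by rewrite /vy; ring.
Qed.

Lemma xc_velocity_geod i s : xc i (velocity geod s) = vx i s.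
Proof.
rewrite xc_velocity; congr (_ s); apply: derive1_eq => r.
rewrite (_ : _ \o _ = fun s => xc i q + (int_cos s * a i + int_sin s * b i)).
  exact: is_derive_eq (derD der_cst (der_X i r)) (add0r _).
by apply/funext => ?; rewrite -xc_geod.
Qed.

Lemma yc_velocity_geod i s : yc i (velocity geod s) = vy i s.
Proof.
rewrite yc_velocity; congr (_ s); apply: derive1_eq => r.
rewrite (_ : _ \o _ = fun s => yc i q + (int_cos s * b i - int_sin s * a i)).
  exact: is_derive_eq (derD der_cst (der_Y i r)) (add0r _).
by apply/funext => ?; rewrite -yc_geod.
Qed.

Hypothesis ab1 : \sum_(i < n) (a i ^+ 2 + b i ^+ 2) = 1.

Lemma horizontal_geod s : horizontal (geod s) (velocity geod s).
Proof.
apply/horizontalP; rewrite /tc [LHS]/=.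
have -> : derive1 (tc \o geod) = fun s =>
    \sum_(i < n) (yc i q * vx i s - xc i q * vy i s) + int_sin s.
  apply: derive1_eq => r; apply: is_derive_eq (derD (derD der_cst (der_sum
    (fun i => derB (derZ (der_X i r)) (derZ (der_Y i r)))))
    (derZ (derB der_id (derZ der_sinM)))) _.
  rewrite add0r; congr (_ + _); rewrite /int_sin mulrA.
  have [->|l0] := eqVneq lam 0; first by rewrite invr0 !mul0r.
  by rewrite mulVf// mul1r.
have E : int_cos s * sin (lam * s) = int_sin s * (1 + cos (lam * s)).
  rewrite /int_cos /int_sin; have S2 := sin2cos2 (lam * s).
  have [->|l0] := eqVneq lam 0; first by rewrite mul0r sin0 cos0; ring.
  rewrite mul0r add0r -mulrA -expr2 S2; ring.
have -> : int_sin s = (int_cos s * sin (lam * s) - int_sin s * cos (lam * s)) *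
    \sum_(i < n) (a i ^+ 2 + b i ^+ 2) by rewrite ab1 E; ring.
rewrite mulr_sumr -big_split; apply: eq_bigr => i _ /=.
by rewrite xc_velocity_geod yc_velocity_geod xc_geod yc_geod /vx /vy; ring.
Qed.

Lemma geodesic_geod L : geodesic lam L geod.
Proof.
split=> [|s _]; first exact: smooth_geod.
split; first exact: horizontal_geod.
  rewrite /mnorm metric_horizontal; last exact: horizontal_geod.
  rewrite (_ : hnorm2 _ = 1) ?sqrtr1// -ab1; apply: eq_bigr => i _.
  rewrite xc_velocity_geod yc_velocity_geod /vx /vy.
  rewrite -[RHS]mul1r -(cos2Dsin2 (lam * s)); ring.
apply/geodesic_eqP; split=> [i|i|].
- rewrite (_ : _ \o _ = vx i); last first.
    by apply/funext => r /=; rewrite xc_velocity_geod.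
  rewrite yc_velocity_geod; have -> // : derive1 (vx i) = fun s => lam * vy i s.
  apply: derive1_eq => r.
  apply: is_derive_eq (derD (derM der_cosM der_cst) (derM der_sinM der_cst)) _.
  by rewrite /vy; ring.
- rewrite (_ : _ \o _ = vy i); last first.
    by apply/funext => r /=; rewrite yc_velocity_geod.
  rewrite xc_velocity_geod; have -> // : derive1 (vy i) = fun s => - (lam * vx i s).
  apply: derive1_eq => r.
  apply: is_derive_eq (derB (derM der_cosM der_cst) (derM der_sinM der_cst)) _.
  by rewrite /vx; ring.
- rewrite (_ : (fun _ => _) = cst 0) ?derive1_cst//; apply/funext => r.
  by rewrite /tcoef; apply/eqP; rewrite subr_eq0; apply/eqP/horizontalP/horizontal_geod.
Qed.

End Curve.
End ExplicitGeodesics.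

Section Existence.
Context {R : realType} {n : nat}.
Implicit Types (p q u v w : heis R n) (g h : R -> heis R n) (lam L s : R).

Lemma heis_ext {u v} : (forall i, xc i u = xc i v) -> (forall i, yc i u = yc i v) ->
  tc u = tc v -> u = v.
Proof.
case: u v => [[ux uy] ut] [[vx vy] vt] Ex Ey Et; congr ((_, _), _).
- by apply/rowP => i; exact: (Ex i).
- by apply/rowP => i; exact: (Ey i).
- exact: Et.
Qed.

Lemma disp_inj {q} : injective (disp q).
Proof.
move=> u v E.
have Ex i : xc i u = xc i v.
  by apply: (addIr (- xc i q)); rewrite -!xc_disp E.
have Ey i : yc i u = yc i v.
  by apply: (addIr (- yc i q)); rewrite -!yc_disp E.
apply: heis_ext => //.
have := congr1 tc E; rewrite !tc_disp => /eqP.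
rewrite (eq_bigr (fun i => yc i q * xc i v - xc i q * yc i v)).
  by move/eqP; lra.
by move=> i _; rewrite Ex Ey.
Qed.

Lemma disp_self p : disp p p = 0.
Proof.
apply: heis_ext => [i|i|]; rewrite ?xc_disp ?yc_disp ?tc_disp ?subrr.
- by rewrite /xc mxE.
- by rewrite /yc mxE.
- by rewrite sub0r big1 ?oppr0// => i _; rewrite mulrC subrr.
Qed.

Lemma hnorm2_eq0 v : hnorm2 v = 0 -> forall i, xc i v = 0 /\ yc i v = 0.
Proof.
move=> /psumr_eq0P v0 i.
have /eqP := v0 (fun i _ => addr_ge0 (sqr_ge0 _) (sqr_ge0 _)) i isT.
by rewrite paddr_eq0 ?sqr_ge0// !sqrf_eq0 => /andP[/eqP ? /eqP ?].
Qed.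

Lemma disp_neq0 q p : p != q ->
  (hnorm2 (disp q p) != 0) || (tc (disp q p) != 0).
Proof.
apply: contraNT; rewrite negb_or !negbK => /andP[/eqP N0 /eqP t0].
apply/eqP/(@disp_inj q); rewrite disp_self.
apply: heis_ext => [i|i|]; last exact: t0.
- by rewrite (hnorm2_eq0 _ N0 i).1 /xc mxE.
- by rewrite (hnorm2_eq0 _ N0 i).2 /yc mxE.
Qed.

Lemma int_cos_sin_sqr lam L (x := lam * L / 2) :
  int_cos lam L ^+ 2 + int_sin lam L ^+ 2 = L ^+ 2 * sinc x ^+ 2.
Proof.
rewrite /int_cos /int_sin; have [l0|l0] := eqVneq lam 0.
  by rewrite /x l0 invr0 !mul0r sinc0 /=; ring.
have l2 : lam ^+ 2 != 0 by rewrite sqrf_eq0.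
apply: (mulfI l2); rewrite mul0r add0r.
have -> : lam ^+ 2 * (L ^+ 2 * sinc x ^+ 2) = 2 * (2 * (x * sinc x) ^+ 2).
  transitivity ((lam * L) ^+ 2 * sinc x ^+ 2); first by ring.
  by rewrite (_ : lam * L = 2 * x); [ring|rewrite /x; field].
rewrite mul_sinc -cos_half !exprMn sin2cos2 exprVn mulrDr !mulrA divff//.
ring.
Qed.

(** The horizontal displacement is obtained from the initial velocity by a
    similarity of squared ratio [N], which is inverted to hit the target; when
    [N = 0] the target is on the vertical axis and any direction will do. The
    height then takes care of itself. *)
Lemma geodesic_of_endpoint q p x L : (0 < n)%N ->
  endpoint (hnorm2 (disp q p)) (tc (disp q p)) x L ->
  exists g, [/\ geodesic (2 * x / L) L g, g 0 = q & g L = p].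
Proof.
move=> n0 [L0 xpi NE tE]; set lam := 2 * x / L; set w := disp q p in NE tE *.
have xE : lam * L / 2 = x by rewrite /lam; field; rewrite gt_eqF.
set K := int_cos lam L; set M := int_sin lam L.
have DE : K ^+ 2 + M ^+ 2 = hnorm2 w by rewrite int_cos_sin_sqr xE NE.
have [a [b [ab1 wx wy]]] : exists a b : 'I_n -> R,
    [/\ \sum_(i < n) (a i ^+ 2 + b i ^+ 2) = 1,
        forall i, K * a i + M * b i = xc i w & forall i, K * b i - M * a i = yc i w].
  have [D0|D0] := eqVneq (hnorm2 w) 0.
    have KM : K = 0 /\ M = 0.
      move: DE; rewrite D0 => /eqP.
      by rewrite paddr_eq0 ?sqr_ge0// !sqrf_eq0 => /andP[/eqP ? /eqP ?].
    exists (fun i => (i == Ordinal n0)%:R), (fun=> 0); split=> [|i|i].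
    - rewrite (bigD1 (Ordinal n0))// eqxx big1 => [|i /negPf ->]; last by rewrite /=; ring.
      by rewrite /=; ring.
    - by rewrite KM.1 KM.2 (hnorm2_eq0 _ D0 i).1; ring.
    - by rewrite KM.1 KM.2 (hnorm2_eq0 _ D0 i).2; ring.
  exists (fun i => (K * xc i w - M * yc i w) / hnorm2 w),
    (fun i => (K * yc i w + M * xc i w) / hnorm2 w); split=> [|i|i].
  - transitivity ((K ^+ 2 + M ^+ 2) / hnorm2 w ^+ 2 * hnorm2 w).
      rewrite [in X in _ * X]/hnorm2 mulr_sumr; apply: eq_bigr => i _.
      by field.
    by rewrite DE; field.
  - by rewrite -DE; field; rewrite DE.
  - by rewrite -DE; field; rewrite DE.
pose g := geod lam q a b.
have g0 : g 0 = q := geod0 lam q a b.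
have gg : geodesic lam L g := geodesic_geod lam q a b ab1 L.
exists g; split=> //; apply: (@disp_inj q); rewrite -/w.
have := geodesic_endpoint L0 gg; rewrite xE g0 => -[_ tg].
apply: heis_ext => [i|i|].
- by rewrite xc_disp xc_geod -/K -/M wx; ring.
- by rewrite yc_disp yc_geod -/K -/M wy; ring.
- by apply: (mulfI (_ : 2 != 0)); rewrite ?pnatr_eq0// tg tE.
Qed.

End Existence.

(** * Calibration *)

Section Calibration.
Context {R : realType} {n : nat}.
Implicit Types (p q u v w : heis R n) (g h : R -> heis R n) (a L s sigma : R).

Lemma derV (f : R -> R) (x df : R) : f x != 0 -> is_derive x 1 f df ->
  is_derive x 1 (fun s => (f s)^-1) (- (f x) ^- 2 * df).
Proof.
move=> fx0 [fd <-]; apply: DeriveDef; first exact: derivableV.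
by rewrite deriveV.
Qed.

(** The solution of the Riccati equation [c' = - (a ^ 2 + c ^ 2)] that blows up
    at [0]: [a cot (a sigma)], or [1 / sigma] if [a = 0]. *)
Definition calib a sigma : R :=
  if a == 0 then sigma^-1 else a * cos (a * sigma) / sin (a * sigma).

Lemma sin_neq0 a sigma : a != 0 -> 0 < sigma -> `|a| * sigma < pi ->
  sin (a * sigma) != 0.
Proof.
move=> a0 s0 spi; have : 0 < sin (`|a| * sigma).
  by apply: sin_gt0_pi; apply/andP; split=> //; rewrite mulr_gt0 ?normr_gt0.
have [_|_] := ger0P a; first by move/lt0r_neq0.
by rewrite mulNr sinN oppr_gt0 => /ltr0_neq0.
Qed.

Lemma der_calib a sigma : 0 < sigma -> `|a| * sigma < pi ->
  is_derive sigma 1 (calib a) (- (a ^+ 2 + calib a sigma ^+ 2)).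
Proof.
move=> s0 spi; rewrite /calib; have [->|a0] := eqVneq a 0.
  have := derV (fun s => s) _ _ (lt0r_neq0 s0) der_id.
  by move/is_derive_eq; apply; rewrite mulr1 exprVn expr0n add0r.
have sn0 := sin_neq0 a sigma a0 s0 spi.
have := derM (derZ der_cosM) (derV (fun s => sin (a * s)) sigma _ sn0 der_sinM).
move=> /(_ a a)/is_derive_eq; apply.
have := sin2cos2 (a * sigma) => S2.
set S := sin _ in sn0 S2 *; set C := cos _ in S2 *.
have -> : a ^+ 2 + (a * C / S) ^+ 2 = a ^+ 2 * (S ^+ 2 + C ^+ 2) / S ^+ 2 by field.
by rewrite mulrDr; field.
Qed.

Definition potential a sigma v : R := calib a sigma * hnorm2 v + 2 * a * tc v.

(** With [m] the speed and [c] the calibration, the Riccati equation turns [m]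
    times the derivative of the difference into the squared norm of
    [v - m (c - a J) z], where [z] is the horizontal displacement and [v] the
    horizontal velocity. The equality case is a geodesic of curvature [2 a]. *)
Lemma potential_le (a : R) q h (sig : R -> R) (r0 r1 : R) : r0 <= r1 ->
  smooth_curve h ->
  (forall r, r0 <= r <= r1 ->
    [/\ horizontal (h r) (velocity h r),
        is_derive r 1 sig (mnorm (h r) (velocity h r)),
        0 < sig r & `|a| * sig r < pi]) ->
  sig r0 - potential a (sig r0) (disp q (h r0)) <=
  sig r1 - potential a (sig r1) (disp q (h r1)).
Proof.
move=> r01 sh H; pose X i r := xc i (disp q (h r)); pose Y i r := yc i (disp q (h r)).
pose vx i r := xc i (velocity h r); pose vy i r := yc i (velocity h r).
pose m r := mnorm (h r) (velocity h r).
pose dPhi r := calib a (sig r) * (\sum_(i < n) (2 * X i r * vx i r + 2 * Y i r * vy i r))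
   + hnorm2 (disp q (h r)) * (- (a ^+ 2 + calib a (sig r) ^+ 2) * m r)
   + 2 * a * \sum_(i < n) (Y i r * vx i r - X i r * vy i r).
apply: (@le_of_der_ge0 _ (fun r => sig r - potential a (sig r) (disp q (h r)))
  (fun r => m r - dPhi r)) => // r /H[hr dsig s0 spi].
  apply: is_derive_eq (derB dsig (derD (derM (der_comp dsig (der_calib a _ s0 spi))
    (der_sum (fun i => derD (derX (der_xc_disp i sh)) (derX (der_yc_disp i sh)))))
    (derZ (der_tc_disp sh hr)))) _.
  by [].
have m0 : 0 <= m r by exact: sqrtr_ge0.
have m2 : m r ^+ 2 = hnorm2 (velocity h r) := mnorm_horizontal _ _ hr.
move: m0; rewrite le_eqVlt => /predU1P[m0|m0].
  have V i : vx i r = 0 /\ vy i r = 0.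
    by apply: hnorm2_eq0; rewrite -m2 -m0 expr0n.
  rewrite /dPhi -m0 !big1 ?mulr0 ?addr0 ?subrr// => i _; case: (V i) => -> ->.
    by rewrite !mulr0 subrr.
  by rewrite !mulr0 addr0.
rewrite -(pmulr_rge0 _ m0).
pose c := calib a (sig r).
have -> : m r * (m r - dPhi r) = \sum_(i < n)
    ((vx i r - c * m r * X i r - a * m r * Y i r) ^+ 2 +
     (vy i r - c * m r * Y i r + a * m r * X i r) ^+ 2).
  transitivity (hnorm2 (velocity h r) +
    (m r ^+ 2 * (a ^+ 2 + c ^+ 2)) * hnorm2 (disp q (h r)) -
    (c * m r) * \sum_(i < n) (2 * X i r * vx i r + 2 * Y i r * vy i r) -
    (2 * a * m r) * \sum_(i < n) (Y i r * vx i r - X i r * vy i r)).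
    by rewrite -m2 /dPhi -/c; ring.
  rewrite /hnorm2 !mulr_sumr -big_split /= -!sumrB; apply: eq_bigr => i _.
  by rewrite /X /Y /vx /vy; ring.
by apply: sumr_ge0 => i _; rewrite addr_ge0 ?sqr_ge0.
Qed.

Lemma continuous_speed h : smooth_curve h ->
  continuous (fun r => mnorm (h r) (velocity h r)).
Proof.
move=> sh r; apply: continuous_comp; last exact: sqrt_continuous.
have dvx i : is_derive r 1 (fun r => xc i (velocity h r))
    (derive1 (derive1 (xc i \o h)) r).
  rewrite (_ : (fun _ => _) = derive1 (xc i \o h)).
    exact/is_derive_smooth/smooth_derive1/(sh.1 i).1.
  by apply/funext => s; rewrite xc_velocity.
have dvy i : is_derive r 1 (fun r => yc i (velocity h r))
    (derive1 (derive1 (yc i \o h)) r).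
  rewrite (_ : (fun _ => _) = derive1 (yc i \o h)).
    exact/is_derive_smooth/smooth_derive1/(sh.1 i).2.
  by apply/funext => s; rewrite yc_velocity.
have dvt : is_derive r 1 (fun r => tc (velocity h r))
    (derive1 (derive1 (tc \o h)) r).
  exact/is_derive_smooth/smooth_derive1/sh.2.
have dtcoef := derB dvt (der_sum (fun i =>
  derB (derM (der_yc i sh) (dvx i)) (derM (der_xc i sh) (dvy i)))).
have [+ _] := derD (der_sum (fun i =>
  derD (derM (dvx i) (dvx i)) (derM (dvy i) (dvy i)))) (derM dtcoef dtcoef).
by move=> /derivable1_diffP/differentiable_continuous.
Qed.

Notation mu := (@lebesgue_measure R).

(** The integral starts at [r0 - 1] so that the primitive is differentiable at
    [r0] too. *)
Lemma speed_primitive h (r0 r1 : R) : r0 < r1 -> smooth_curve h ->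
  exists2 sig : R -> R,
    (forall r, r0 <= r <= r1 ->
      is_derive r 1 sig (mnorm (h r) (velocity h r))) &
    (\int[mu]_(r in `[r0, r1]) (mnorm (h r) (velocity h r))%:E =
      (sig r1)%:E - (sig r0)%:E)%E.
Proof.
move=> r01 sh; pose f r := mnorm (h r) (velocity h r).
have cf : continuous f := continuous_speed h sh.
pose sig r : R := (\int[mu]_(t in [set` `[r0 - 1, r]%R]) f t)%R.
have dsig r : r0 <= r <= r1 -> is_derive r 1 sig (f r).
  move=> /andP[r0r rr1].
  have [||||d1 d2] := @continuous_FTC1_closed R f (r0 - 1) r (r1 + 1).
  - by lra.
  - apply: continuous_compact_integrable; first exact: segment_compact.
    exact: continuous_subspaceT.
  - by lra.
  - exact: cf.
  by apply: DeriveDef; [exact: d1|rewrite -derive1E; exact: d2].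
exists sig => //.
have cs r : r0 <= r <= r1 -> {for r, continuous sig}.
  by move=> /dsig[+ _] => /derivable1_diffP/differentiable_continuous.
apply: continuous_FTC2 => //.
- exact: continuous_subspaceT.
- split=> [r||].
  + by rewrite in_itv /= => /andP[/ltW r0r /ltW rr1]; have [] := dsig r; rewrite ?r0r.
  + by apply: cvg_at_right_filter; apply: cs; rewrite lexx ltW.
  + by apply: cvg_at_left_filter; apply: cs; rewrite lexx ltW.
- move=> r; rewrite in_itv /= => /andP[/ltW r0r /ltW rr1].
  by rewrite derive1E; have [|_ ->] := dsig r; rewrite ?r0r.
Qed.

End Calibration.

(** * Length of piecewise smooth horizontal curves *)

Section LowerBound.
Context {R : realType} {n : nat}.
Implicit Types (p q u v w : heis R n) (g h : R -> heis R n) (a L s sigma : R).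
Notation mu := (@lebesgue_measure R).

Definition speed g (r : R) : R := mnorm (g r) (velocity g r).

Lemma itv_integral_split (f : R -> R) (r0 r1 r2 : R) : r0 <= r1 -> r1 <= r2 ->
  (forall r, 0 <= f r) ->
  measurable_fun `[r0, r1] f -> measurable_fun `[r1, r2] f ->
  measurable_fun `[r0, r2] f /\
  (\int[mu]_(r in `[r0, r2]) (f r)%:E =
   \int[mu]_(r in `[r0, r1]) (f r)%:E + \int[mu]_(r in `[r1, r2]) (f r)%:E)%E.
Proof.
move=> r01 r12 f0 m1 m2.
have m2' : measurable_fun `]r1, r2] f by apply/measurable_fun_itv_obnd_cbndP.
have E : `[r0, r2]%classic = `[r0, r1]%classic `|` `]r1, r2]%classic.
  by rewrite -itv_bndbnd_setU.
have m02 : measurable_fun `[r0, r2] f.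
  by rewrite E; apply/measurable_funU.
split=> //; rewrite E ge0_integral_setU//=.
- by rewrite integral_itv_obnd_cbnd//; apply/measurable_EFinP.
- by rewrite -E; apply/measurable_EFinP.
- by move=> x _; rewrite lee_fin.
- rewrite disj_set2E; apply/eqP/seteqP; split=> // x /=.
  by rewrite !in_itv /= => -[/andP[_ xr1] /andP[/lt_le_trans/(_ xr1)]]; rewrite ltxx.
Qed.

(** What the calibration gives on one smooth piece, for every initial value
    [sigma] of the arc length, so that it is preserved by concatenation. *)
Definition calibrated a q g (r0 r1 : R) : Prop :=
  measurable_fun `[r0, r1] (speed g) /\
  exists l : R, [/\ 0 <= l,
    (\int[mu]_(r in `[r0, r1]) (speed g r)%:E = l%:E)%E &
    forall sigma, 0 < sigma -> `|a| * (sigma + l) < pi ->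
      sigma - potential a sigma (disp q (g r0)) <=
      sigma + l - potential a (sigma + l) (disp q (g r1))].

Lemma calibrated_refl a q g r : calibrated a q g r r.
Proof.
rewrite /calibrated set_itv1; split; first exact: measurable_fun_set1.
exists 0; split=> //; first by rewrite integral_set1.
by move=> sigma _ _; rewrite addr0.
Qed.

Lemma calibrated_trans a q g (r0 r1 r2 : R) : r0 <= r1 -> r1 <= r2 ->
  calibrated a q g r0 r1 -> calibrated a q g r1 r2 -> calibrated a q g r0 r2.
Proof.
move=> r01 r12 [m1 [l1 [l10 E1 H1]]] [m2 [l2 [l20 E2 H2]]].
have [m E] := itv_integral_split (speed g) r0 r1 r2 r01 r12
  (fun r => sqrtr_ge0 _) m1 m2.
split=> //; exists (l1 + l2); split; first exact: addr_ge0.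
  by rewrite E E1 E2.
move=> sigma s0; rewrite addrA => spi; apply: le_trans (H2 _ _ spi).
  apply: H1 => //; apply: le_lt_trans spi.
  by rewrite ler_wpM2l// lerDl.
by rewrite ltr_pwDl.
Qed.

Lemma speed_eq_near g h (r0 r1 r : R) : (forall r, r0 <= r <= r1 -> g r = h r) ->
  r0 < r < r1 -> speed g r = speed h r.
Proof.
move=> gh /andP[r0r rr1].
have N : \forall s \near r, g s = h s.
  have : \forall s \near r, s \in `]r0, r1[.
    by apply: near_in_itvoo; rewrite in_itv /= r0r.
  apply: filterS => s; rewrite in_itv /= => /andP[/ltW r0s /ltW sr1].
  by apply: gh; rewrite r0s.
have D (f : heis R n -> R) : derive1 (f \o g) r = derive1 (f \o h) r.
  rewrite !derive1E; apply: near_eq_derive.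
  by apply: filterS N => s /= ->.
have gr : g r = h r by apply: gh; apply/andP; split; exact: ltW.
have V : velocity g r = velocity h r.
  by apply: heis_ext => [i|i|]; rewrite ?xc_velocity ?yc_velocity; exact: D.
by rewrite /speed gr V.
Qed.

Lemma calibrated_piece a q g h (r0 r1 : R) : r0 < r1 -> smooth_curve h ->
  (forall r, r \in `[r0, r1] -> g r = h r /\ horizontal (h r) (velocity h r)) ->
  calibrated a q g r0 r1.
Proof.
move=> r01 sh gh.
have ghE r : r0 <= r <= r1 -> g r = h r by move=> rr; case: (gh r).
have mh D : measurable D -> measurable_fun D (speed h).
  by move=> mD; apply: measurable_funTS; apply: continuous_measurable_fun;
     exact: continuous_speed.
have Eoo : {in `]r0, r1[%classic, speed h =1 speed g}.
  move=> r; rewrite inE /= in_itv /= => rr.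
  by rewrite (@speed_eq_near g h r0 r1).
have mg : measurable_fun `]r0, r1[ (speed g).
  exact: eq_measurable_fun Eoo (mh _ _).
have [sig dsig Isig] := speed_primitive h r0 r1 r01 sh.
split; first exact: measurable_fun_itv_cc mg.
exists (sig r1 - sig r0).
have mono r : r0 <= r <= r1 -> sig r0 <= sig r.
  move=> /andP[r0r rr1]; apply: le_of_der_ge0 r0r _ _ => s /andP[r0s sr].
    by apply: dsig; rewrite r0s (le_trans sr).
  exact: sqrtr_ge0.
have mono' r : r0 <= r <= r1 -> sig r <= sig r1.
  move=> /andP[r0r rr1]; apply: le_of_der_ge0 rr1 _ _ => s /andP[rs sr].
    by apply: dsig; rewrite sr (le_trans r0r).
  exact: sqrtr_ge0.
have r0in : r0 <= r0 <= r1 by rewrite lexx ltW.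
have r1in : r0 <= r1 <= r1 by rewrite lexx ltW.
split; first by rewrite subr_ge0 mono.
  rewrite integral_itv_bndoo; last exact/measurable_EFinP.
  rewrite -EFinB in Isig; rewrite -Isig [RHS]integral_itv_bndoo; last first.
    by apply/measurable_EFinP; apply: mh; exact: measurable_itv.
  by apply: eq_integral => r rr; rewrite -Eoo.
move=> sigma s0 spi; rewrite !ghE//.
have := @potential_le _ _ a q h (fun r => sigma + (sig r - sig r0)) r0 r1 (ltW r01) sh.
rewrite subrr addr0; apply=> r rr.
have rr' : r \in `[r0, r1] by rewrite in_itv.
have [_ hr] := gh r rr'; split=> //.
- apply: is_derive_eq (derD der_cst (derB (dsig r rr) der_cst)) _.
  by rewrite add0r subr0.
- by rewrite ltr_pwDl// subr_ge0 mono.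
- apply: le_lt_trans spi; rewrite ler_wpM2l// lerD2l lerD2r; exact: mono'.
Qed.

Lemma horizontal_curve_calibrated a q g (r0 r1 : R) :
  horizontal_curve r0 r1 g -> r0 <= r1 /\ calibrated a q g r0 r1.
Proof.
move=> [s [+ <-]]; elim: s r0 => [|t s IHs] r0 /=.
  by move=> _ _; split=> //; exact: calibrated_refl.
move=> /andP[r0t ps] H.
have [ts ct] : t <= last t s /\ calibrated a q g t (last t s).
  apply: IHs => // k ks; have [h sh gh] := H k.+1 ks; exists h => // r rk.
  apply: gh; move: rk; rewrite (@set_nth_default _ s r0 t k ks).
  by rewrite (@set_nth_default _ (t :: s) r0 t k)//= ltnS ltnW.
split; first exact: le_trans (ltW r0t) ts.
apply: calibrated_trans ct => //; first exact: ltW.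
by have [h sh gh] := H 0%N isT; exact: calibrated_piece gh.
Qed.

End LowerBound.

(** * The distance and the curvature of minimizing geodesics *)

Section Distance.
Context {R : realType} {n : nat}.
Implicit Types (p q u v w : heis R n) (g h : R -> heis R n) (a L s sigma : R).
Notation mu := (@lebesgue_measure R).

Lemma calibN a sigma : calib (- a) sigma = calib a sigma.
Proof.
rewrite /calib oppr_eq0; case: eqP => // _.
by rewrite !mulNr sinN cosN invrN mulrN opprK.
Qed.

(** With [a = x / L], the right side equals
    [L + sin x sin (x - a s) / (a sin (a s))] if [x <> 0], and the four factors
    of the last term have the sign of [x] or vanish; so it is at least [L]. *)
Lemma potential_endpoint (N tau x L s : R) : endpoint N tau x L -> 0 < s < L ->
  s <= calib (x / L) s * N + 2 * (x / L) * tau.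
Proof.
move=> + sL; wlog x0 : x tau / 0 <= x => [H|].
  have [x0|/ltW] := leP 0 x; first exact: H.
  rewrite -oppr_ge0 => /H H' /endpointN/H'.
  by rewrite mulNr calibN !mulrN mulNr opprK.
case=> L0 xpi -> tE; have /andP[s0 sL'] := sL.
have [x00|xn0] := eqVneq x 0.
  move: tE; rewrite x00 kap0 sinc0 mul0r /calib eqxx => tE.
  rewrite expr1n !mulr0 mul0r addr0 mulr1 -(ler_pM2l s0) mulrA divff ?gt_eqF//.
  by rewrite mul1r -expr2 ler_sqr ?nnegrE ltW.
have {x0} x0 : 0 < x by rewrite lt_def xn0.
rewrite (ger0_norm (ltW x0)) in xpi.
set a := x / L; have a0 : 0 < a by rewrite divr_gt0.
have aL : a * L = x by rewrite /a divfK ?gt_eqF.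
have u0 : 0 < a * s by rewrite mulr_gt0.
have ux : a * s < x by rewrite -aL ltr_pM2l.
have Su : 0 < sin (a * s).
  by apply: sin_gt0_pi; rewrite u0/=; apply: lt_le_trans xpi.
have Sx : 0 <= sin x by apply: sin_ge0_pi; rewrite xpi ltW.
have Sd : 0 <= sin (x - a * s).
  by apply: sin_ge0_pi; apply/andP; split; lra.
rewrite /calib gt_eqF//.
have -> : L ^+ 2 * sinc x ^+ 2 = sin x ^+ 2 / a ^+ 2.
  by rewrite -mul_sinc -aL; field; rewrite gt_eqF.
have -> : 2 * a * tau = L - sin x * cos x / a.
  rewrite mulrAC tE -[L in RHS](mulfK (lt0r_neq0 a0)) [L * a]mulrC aL -mulrBl.
  by rewrite -mul_kap -aL; field; rewrite gt_eqF.
apply: (le_trans (ltW sL')); rewrite -subr_ge0.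
have -> : a * cos (a * s) / sin (a * s) * (sin x ^+ 2 / a ^+ 2) +
    (L - sin x * cos x / a) - L = sin x * sin (x - a * s) / (a * sin (a * s)).
  by rewrite sinB; field; rewrite !gt_eqF.
by rewrite divr_ge0// mulr_ge0// ltW.
Qed.

(** If the length [l] were less than [L], the calibration could be started at a
    small positive [sigma], where it is not singular, and would still end before
    [L]; it would contradict [potential_endpoint]. *)
Lemma endpoint_le_length {q p x L} {r0 r1 : R} {g} :
  endpoint (hnorm2 (disp q p)) (tc (disp q p)) x L ->
  horizontal_curve r0 r1 g -> g r0 = q -> g r1 = p ->
  (L%:E <= curve_length r0 r1 g)%E.
Proof.
move=> E hg g0 g1.
have [_ [_ [l [l0 lE H]]]] := horizontal_curve_calibrated (x / L) q g r0 r1 hg.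
rewrite /curve_length lE lee_fin leNgt; apply/negP => lL.
have L0 : 0 < L by case: E.
pose sigma := (L - l) / 2; have s0 : 0 < sigma by rewrite divr_gt0 ?subr_gt0.
have sL : 0 < sigma + l < L by apply/andP; split; rewrite /sigma; lra.
have spi : `|x / L| * (sigma + l) < pi.
  have xpi : `|x / L| * L <= pi.
    have [_ + _ _] := E; rewrite -{1}(divfK (lt0r_neq0 L0) x) normrM.
    by rewrite (ger0_norm (ltW L0)).
  have [->|x0] := eqVneq `|x / L| 0; first by rewrite mul0r pi_gt0.
  apply: lt_le_trans xpi; rewrite ltr_pM2l ?(andP sL).2//.
  by rewrite lt_def x0 normr_ge0.
have := H _ s0 spi; rewrite g0 g1 disp_self.
have -> : potential (x / L) sigma (0 : heis R n) = 0.
  rewrite /potential /hnorm2 big1 ?mulr0 ?addr0// => i _.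
  by rewrite /xc /yc !mxE !expr0n addr0.
have := potential_endpoint _ _ _ _ _ E sL; rewrite /potential.
by lra.
Qed.

Lemma geodesic_length {lam L g} : 0 < L -> geodesic lam L g ->
  horizontal_curve 0 L g /\ curve_length 0 L g = L%:E.
Proof.
move=> L0 [sg gg]; split.
  exists [:: L]; split=> //=; first by rewrite L0.
  case=> // _; exists g => // r rL.
  by have [] := gg r rL.
rewrite /curve_length (@eq_integral _ _ _ _ _ (cst 1%E)) => [|r].
  rewrite integral_cst//= mul1e lebesgue_measure_itv/= lte_fin L0.
  by rewrite sube0.
by rewrite inE /= => rL; have [_ ->] := gg r rL.
Qed.

Lemma ccdist_endpoint {q p x L} : (0 < n)%N ->
  endpoint (hnorm2 (disp q p)) (tc (disp q p)) x L -> ccdist q p = L%:E.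
Proof.
move=> n0 E; have L0 : 0 < L by case: E.
apply/eqP; rewrite eq_le; apply/andP; split.
  have [g [gg g0 g1]] := geodesic_of_endpoint q p x L n0 E.
  have [hg <-] := geodesic_length L0 gg.
  by apply: ereal_inf_lbound; exists 0, L, g.
apply: le_ereal_inf_tmp => _ [r0 [r1 [g [hg g0 g1 ->]]]].
exact: (endpoint_le_length E hg g0 g1).
Qed.

Lemma hnorm2_disp_sym q p : hnorm2 (disp q p) = hnorm2 (disp p q).
Proof.
apply: eq_bigr => i _; rewrite !xc_disp !yc_disp.
by rewrite -sqrrN opprB; congr (_ + _); rewrite -sqrrN opprB.
Qed.

Lemma tc_disp_sym q p : tc (disp q p) = - tc (disp p q).
Proof.
rewrite !tc_disp.
rewrite (_ : \sum_(i < n) (yc i q * xc i p - xc i q * yc i p) =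
  - \sum_(i < n) (yc i p * xc i q - xc i p * yc i q)); first by ring.
by rewrite -sumrN; apply: eq_bigr => i _; ring.
Qed.

Definition reach q p x L := endpoint (hnorm2 (disp q p)) (tc (disp q p)) x L.

Lemma reach_sym {q p x L} : reach q p x L -> reach p q (- x) L.
Proof. by rewrite /reach hnorm2_disp_sym tc_disp_sym => /endpointN; rewrite opprK. Qed.

Lemma reach_exists q p : p != q -> exists x L, reach q p x L.
Proof.
by move=> pq; apply: endpoint_exists; [exact: hnorm2_ge0|exact: disp_neq0].
Qed.

(** The length is the distance; then [sinc_kap_inj] applies. *)
Lemma reach_uniq {q p x L y M} : (0 < n)%N -> reach q p x L -> reach q p y M ->
  x = y /\ L = M.
Proof.
move=> n0 E1 E2; have LM : L = M.
  by have := ccdist_endpoint n0 E1; rewrite (ccdist_endpoint n0 E2) => -[].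
split=> //; case: E1 E2 => L0 _ N1 t1 [_ _ N2 t2].
have L2 : L ^+ 2 != 0 by rewrite sqrf_eq0 gt_eqF.
apply: sinc_kap_inj; apply: (mulfI L2).
  by rewrite -N1 [in RHS]LM.
by rewrite -t1 [in RHS]LM.
Qed.

(** A minimizing geodesic, whatever its curvature, has the same length and the
    same end points as the one with half angle in [[- pi, pi]]; as [sinc_kap_inj]
    holds for all angles, their half angles agree. *)
Lemma reach_curvature {q p x L lam M g} : (0 < n)%N -> reach q p x L ->
  minimizing_geodesic lam M g q p -> lam = 2 * x / L.
Proof.
move=> n0 E [M0 gg g0 gM lenE].
have ML : M = L.
  have [_] := geodesic_length M0 gg; rewrite lenE (ccdist_endpoint n0 E).
  by case.
have [N t] := geodesic_endpoint M0 gg; rewrite g0 gM ML in N t.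
case: E => L0 _ N1 t1.
have L2 : L ^+ 2 != 0 by rewrite sqrf_eq0 gt_eqF.
have -> : x = lam * L / 2.
  by apply: sinc_kap_inj; apply: (mulfI L2); rewrite -?N1 -?t1.
by field; rewrite gt_eqF.
Qed.

Lemma curvature_reach {E : set (heis R n)} {p x L} : (0 < n)%N ->
  reach (xi E p) p x L -> curvature E p = 2 * x / L.
Proof.
move=> n0 rE; rewrite /curvature; case: xgetP => [lam _ [M [g mg]]|none].
  exact: reach_curvature rE mg.
have [g [gg g0 gL]] := geodesic_of_endpoint _ _ _ _ n0 rE.
have L0 : 0 < L by case: rE.
have [] := none (2 * x / L); exists L, g; split=> //.
by rewrite (geodesic_length L0 gg).2 (ccdist_endpoint n0 rE).
Qed.

End Distance.

(** * Continuity of the distance and of the nearest point *)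

Section Limits.
Context {R : realType} {n : nat} {T : Type} {F : set_system T} {FF : ProperFilter F}.
Implicit Types (q p : T -> heis R n).

Lemma cvg_xc p (p0 : heis R n) i : p @ F --> p0 -> xc i (p t) @[t --> F] --> xc i p0.
Proof.
move=> pp0; have c11 : {for p0, continuous (fun v : heis R n => v.1.1)}.
  by apply: (@continuous_comp _ _ _ fst fst); [exact: cvg_fst|exact: cvg_fst].
exact: (cvg_comp _ _ (cvg_comp _ _ pp0 c11) (@coord_continuous R 1 n 0 i _)).
Qed.

Lemma cvg_yc p (p0 : heis R n) i : p @ F --> p0 -> yc i (p t) @[t --> F] --> yc i p0.
Proof.
move=> pp0; have c12 : {for p0, continuous (fun v : heis R n => v.1.2)}.
  by apply: (@continuous_comp _ _ _ fst snd); [exact: cvg_fst|exact: cvg_snd].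
exact: (cvg_comp _ _ (cvg_comp _ _ pp0 c12) (@coord_continuous R 1 n 0 i _)).
Qed.

Lemma cvg_tc p (p0 : heis R n) : p @ F --> p0 -> tc (p t) @[t --> F] --> tc p0.
Proof. by move=> pp0; apply: (cvg_comp _ _ pp0); exact: cvg_snd. Qed.

Lemma cvg_sum_ord (f : 'I_n -> T -> R) (l : 'I_n -> R) :
  (forall i, f i @ F --> l i) ->
  \sum_(i < n) f i t @[t --> F] --> \sum_(i < n) l i.
Proof.
by move=> fl; apply: cvg_big => //; exact: add_continuous.
Qed.

Lemma cvg_hnorm2_disp q p (q0 p0 : heis R n) : q @ F --> q0 -> p @ F --> p0 ->
  hnorm2 (disp (q t) (p t)) @[t --> F] --> hnorm2 (disp q0 p0).
Proof.
move=> qq0 pp0; apply: cvg_sum_ord => i.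
have X : xc i (disp (q t) (p t)) @[t --> F] --> xc i (disp q0 p0).
  under eq_cvg do rewrite xc_disp.
  by rewrite xc_disp; apply: cvgB; exact: cvg_xc.
have Y : yc i (disp (q t) (p t)) @[t --> F] --> yc i (disp q0 p0).
  under eq_cvg do rewrite yc_disp.
  by rewrite yc_disp; apply: cvgB; exact: cvg_yc.
by apply: cvgD; [exact: (cvgM X X)|exact: (cvgM Y Y)].
Qed.

Lemma cvg_tc_disp q p (q0 p0 : heis R n) : q @ F --> q0 -> p @ F --> p0 ->
  tc (disp (q t) (p t)) @[t --> F] --> tc (disp q0 p0).
Proof.
move=> qq0 pp0; apply: cvgB; first by apply: cvgB; exact: cvg_tc.
apply: cvg_sum_ord => i; apply: cvgB; apply: cvgM;
  by [exact: cvg_xc|exact: cvg_yc].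
Qed.

End Limits.

Section Continuity.
Context {R : realType} {n : nat}.
Hypothesis n0 : (0 < n)%N.
Implicit Types (E : set (heis R n)).

(** As [sinc x ^ 2 + |kap x|] is bounded below on [[- pi, pi]], the length is
    bounded and [(x, L)] stays in a compact set; a limit point solves the
    equations of the limit, whose solution is unique. A limit point with [L = 0]
    would force the two end points to coincide. *)
Lemma reach_cvg {T : Type} {F : set_system T} {FF : ProperFilter F}
    {q p : T -> heis R n} {x L : T -> R} {q0 p0 : heis R n} {x0 L0 : R} :
  q @ F --> q0 -> p @ F --> p0 ->
  (\forall t \near F, reach (q t) (p t) (x t) (L t)) ->
  reach q0 p0 x0 L0 -> x @ F --> x0 /\ L @ F --> L0.
Proof.
move=> qq0 pp0 rF r0.
have [m m0 mle] := @sinc_kap_lower_bound R.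
pose N t := hnorm2 (disp (q t) (p t)); pose tau t := tc (disp (q t) (p t)).
have NN : N @ F --> hnorm2 (disp q0 p0) by exact: cvg_hnorm2_disp.
have tt : tau @ F --> tc (disp q0 p0) by exact: cvg_tc_disp.
pose B := hnorm2 (disp q0 p0) + 2 * `|tc (disp q0 p0)| + 1.
have NB : \forall t \near F, N t + 2 * `|tau t| <= B.
  have NtB : N t + 2 * `|tau t| @[t --> F] -->
      hnorm2 (disp q0 p0) + 2 * `|tc (disp q0 p0)|.
    by apply: cvgD => //; apply: cvgM; [exact: cvg_cst|exact: cvg_norm].
  by apply: (cvgr_le _ NtB); rewrite ltrDl.
pose K : set (R * R) := `[- pi, pi] `*` `[0, 1 + B / m].
have fF : (fun t => (x t, L t)) @ F --> (x0, L0).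
  apply: (@cvg_of_compact _ _ F _ _ K).
  - by apply: compact_setX; exact: segment_compact.
  - apply: filterS2 rF NB => t [L0t xpi NE tE] tB; split=> /=.
      by rewrite in_itv /= -ler_norml.
    rewrite in_itv /= ltW//=.
    have H : L t ^+ 2 <= B / m.
      rewrite ler_pdivlMr//; apply: (le_trans (ler_wpM2l (sqr_ge0 _) (mle _ xpi))).
      rewrite mulrDr -NE -[X in X * `|_|](ger0_norm (sqr_ge0 (L t))) -normrM -tE.
      by rewrite normrM normr_nat.
    by have := sqr_ge0 (L t - 1); have := sqr_ge0 (L t); lra.
  - move=> G PG FG [y1 y2] fy.
    have xy : x @ G --> y1 by apply: (cvg_comp _ fst fy); exact: cvg_fst.
    have Ly : L @ G --> y2 by apply: (cvg_comp _ snd fy); exact: cvg_snd.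
    have L2 : L t ^+ 2 @[t --> G] --> y2 ^+ 2
      by exact: (cvgM Ly Ly).
    have sy : sinc (x t) @[t --> G] --> sinc y1.
      by apply: (cvg_comp _ _ xy); exact: continuous_sinc.
    have ky : kap (x t) @[t --> G] --> kap y1.
      by apply: (cvg_comp _ _ xy); exact: continuous_kap.
    have s2 : sinc (x t) ^+ 2 @[t --> G] --> sinc y1 ^+ 2
      by exact: (cvgM sy sy).
    have rG := FG _ rF.
    have NG : N @ G --> hnorm2 (disp q0 p0) by apply: cvg_trans NN => A; exact: FG.
    have tG : tau @ G --> tc (disp q0 p0) by apply: cvg_trans tt => A; exact: FG.
    have N1 : hnorm2 (disp q0 p0) = y2 ^+ 2 * sinc y1 ^+ 2.
      have sG : L t ^+ 2 * sinc (x t) ^+ 2 @[t --> G] --> y2 ^+ 2 * sinc y1 ^+ 2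
      by exact: (cvgM L2 s2).
      apply: (norm_cvg_unique NG); apply: cvg_trans sG.
      by apply: near_eq_cvg; apply: filterS rG => t [].
    have t1 : 2 * tc (disp q0 p0) = y2 ^+ 2 * kap y1.
      have tG2 : 2 * tau t @[t --> G] --> 2 * tc (disp q0 p0)
      by apply: cvgM => //; exact: cvg_cst.
      have kG : L t ^+ 2 * kap (x t) @[t --> G] --> y2 ^+ 2 * kap y1
      by exact: (cvgM L2 ky).
      apply: (norm_cvg_unique tG2). apply: cvg_trans kG.
      by apply: near_eq_cvg; apply: filterS rG => t [].
    have y2ge0 : 0 <= y2.
      by apply: cvgr_to_ge Ly _; apply: filterS rG => t [/ltW].
    have y1pi : `|y1| <= pi.
      by apply: cvgr_to_le (cvg_norm xy) _; apply: filterS rG => t [].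
    suff ry : reach q0 p0 y1 y2 by have [-> ->] := reach_uniq n0 ry r0.
    split=> //; rewrite lt_def y2ge0 andbT; apply/eqP => y20.
    have [L00 _ N0 t0] := r0.
    have L2n : L0 ^+ 2 != 0 by rewrite sqrf_eq0 gt_eqF.
    have s0 : sinc x0 ^+ 2 = 0.
      by apply: (mulfI L2n); rewrite -N0 N1 y20 expr0n !mul0r mulr0.
    have k0 : kap x0 = 0.
      by apply: (mulfI L2n); rewrite -t0 t1 y20 expr0n mul0r mulr0.
    by have := sinc_kap_gt0 x0; rewrite s0 k0 normr0 addr0 ltxx.
split; first by apply: (cvg_comp _ fst fF); exact: cvg_fst.
by apply: (cvg_comp _ snd fF); exact: cvg_snd.
Qed.

End Continuity.

Section Projection.
Context {R : realType} {n : nat}.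
Implicit Types (E : set (heis R n)) (p q w : heis R n).

(** The group law for which the frame is left-invariant. *)
Definition translate p w : heis R n :=
  ((p.1.1 + w.1.1, p.1.2 + w.1.2),
   tc p + tc w + \sum_(i < n) (yc i p * xc i w - xc i p * yc i w)).

Lemma xc_translate p w i : xc i (translate p w) = xc i p + xc i w.
Proof. by rewrite /xc /= mxE. Qed.

Lemma yc_translate p w i : yc i (translate p w) = yc i p + yc i w.
Proof. by rewrite /yc /= mxE. Qed.

Lemma tc_translate p w : tc (translate p w) =
  tc p + tc w + \sum_(i < n) (yc i p * xc i w - xc i p * yc i w).
Proof. by []. Qed.

Lemma dispK p q : translate p (disp p q) = q.
Proof.
apply: heis_ext => [i|i|].
- by rewrite xc_translate xc_disp addrC subrK.
- by rewrite yc_translate yc_disp addrC subrK.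
rewrite tc_translate tc_disp.
have -> : \sum_(i < n) (yc i p * xc i (disp p q) - xc i p * yc i (disp p q)) =
    \sum_(i < n) (yc i p * xc i q - xc i p * yc i q).
  by apply: eq_bigr => i _; rewrite xc_disp yc_disp; ring.
by ring.
Qed.

Lemma translateK p w : disp p (translate p w) = w.
Proof.
apply: heis_ext => [i|i|].
- by rewrite xc_disp xc_translate addrC addKr.
- by rewrite yc_disp yc_translate addrC addKr.
rewrite tc_disp tc_translate.
have -> : \sum_(i < n) (yc i p * xc i (translate p w) -
    xc i p * yc i (translate p w)) =
    \sum_(i < n) (yc i p * xc i w - xc i p * yc i w).
  by apply: eq_bigr => i _; rewrite xc_translate yc_translate; ring.
by ring.
Qed.

Lemma cvg_pair_nbhs {T : Type} {F : set_system T} {FF : Filter F}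
    {U V : topologicalType} {f : T -> U} {g : T -> V} {a : U} {b : V} :
  f @ F --> a -> g @ F --> b -> (f t, g t) @[t --> F] --> (a, b).
Proof. by move=> fa gb; exact: (cvg_pair fa gb). Qed.

Lemma cvg_translate {T : Type} {F : set_system T} {FF : ProperFilter F}
    (p w : T -> heis R n) (p0 w0 : heis R n) :
  p @ F --> p0 -> w @ F --> w0 ->
  translate (p t) (w t) @[t --> F] --> translate p0 w0.
Proof.
move=> pp0 ww0.
have c1 : (fun t => (p t).1) @ F --> p0.1 by apply: (cvg_comp _ fst pp0); exact: cvg_fst.
have c2 : (fun t => (w t).1) @ F --> w0.1 by apply: (cvg_comp _ fst ww0); exact: cvg_fst.
apply: cvg_pair_nbhs; first apply: cvg_pair_nbhs.
- apply: cvgD; first by apply: (cvg_comp _ fst c1); exact: cvg_fst.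
  by apply: (cvg_comp _ fst c2); exact: cvg_fst.
- apply: cvgD; first by apply: (cvg_comp _ snd c1); exact: cvg_snd.
  by apply: (cvg_comp _ snd c2); exact: cvg_snd.
apply: cvgD; first by apply: cvgD; exact: cvg_tc.
apply: cvg_sum_ord => i; apply: cvgB; apply: cvgM;
  by [exact: cvg_xc|exact: cvg_yc].
Qed.

Lemma compact_box (B : R) : compact [set w : heis R n | (forall i, `|xc i w| <= B) /\
  (forall i, `|yc i w| <= B) /\ `|tc w| <= B].
Proof.
have cB : compact `[- B, B] by exact: segment_compact.
rewrite (_ : mkset _ =
  ([set v : 'rV[R]_n | forall i, `[- B, B]%classic (v ord0 i)] `*`
   [set v : 'rV[R]_n | forall i, `[- B, B]%classic (v ord0 i)]) `*` `[- B, B]).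
  have cv : compact [set v : 'rV[R]_n | forall i, `[- B, B]%classic (v ord0 i)].
    by apply: (@rV_compact _ _ (fun=> `[- B, B]%classic)).
  exact: compact_setX (compact_setX cv cv) cB.
apply/seteqP; split=> -[[x y] t] /=; rewrite ?in_itv/= -?ler_norml /xc /yc /tc /=.
  move=> [hx [hy ht]]; split=> //; split=> i; rewrite in_itv /= -ler_norml//.
  by move=> [[hx hy] ht]; split; [|split] => // i; [have := hx i|have := hy i];
    rewrite in_itv /= -ler_norml.
Qed.

End Projection.

Section NearestPoint.
Context {R : realType} {n : nat}.
Hypothesis n0 : (0 < n)%N.
Variable E : set (heis R n).
Hypothesis clE : closed E.
Implicit Types (p q w : heis R n).

Lemma nearest_xi p : Unp E p -> nearest E p (xi E p).
Proof. by move=> [q [nq _]]; apply: (getI (x := q)). Qed.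

Lemma xi_uniq p q : Unp E p -> nearest E p q -> q = xi E p.
Proof. by move=> [r [_ u]] nq; rewrite -(u _ nq); apply: u; apply: (getI (x := q)). Qed.

(** Half angle and length of the minimizing geodesics from [q] to [p <> q]. *)
Definition param q p : R * R := get [set xL : R * R | reach q p xL.1 xL.2].

Lemma reach_param q p : ~ E p -> E q -> reach q p (param q p).1 (param q p).2.
Proof.
move=> nEp Eq; have pq : p != q by apply/eqP => pq; apply: nEp; rewrite pq.
have [x [L r]] := reach_exists q p pq.
exact: (getI (x := (x, L)) (P := [set xL : R * R | reach q p xL.1 xL.2])).
Qed.

Lemma ccdist_param q p : ~ E p -> E q -> ccdist p q = (param q p).2%:E.
Proof.
by move=> nEp Eq; exact: ccdist_endpoint n0 (reach_sym (reach_param q p nEp Eq)).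
Qed.

(** Compactness is applied to the displacement [w] from [p] to [xi E p], whose
    coordinates are bounded in terms of the distance from [p] to the fixed point
    [xi E p0]. *)
Lemma xi_cvg p0 : (Unp E `\` E) p0 ->
  xi E p @[p --> within (Unp E `\` E) (nbhs p0)] --> xi E p0.
Proof.
move=> Ap0; have [Up0 nEp0] := Ap0.
set F := within _ _.
have PF : ProperFilter F.
  split; last exact: within_filter.
  move=> /(@nbhs_singleton _ p0); exact.
have FA : \forall p \near F, (Unp E `\` E) p by exact: withinT.
have Fp : p @[p --> F] --> p0 by exact: cvg_within.
have xiE p : Unp E p -> E (xi E p) by move=> /nearest_xi[].
have Lle p r : (Unp E `\` E) p -> E r -> (param (xi E p) p).2 <= (param r p).2.
  move=> [Up nEp] Er; have [Ex /(_ r Er)] := nearest_xi p Up.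
  by rewrite !ccdist_param// lee_fin.
have Lcvg (G : set_system (heis R n)) r : ProperFilter G -> F `<=` G -> E r ->
    (param r p).2 @[p --> G] --> (param r p0).2.
  move=> PG FG Er; have Gp : p @[p --> G] --> p0.
    by apply: cvg_trans Fp => A; exact: FG.
  apply: (proj2 (reach_cvg n0 (cvg_cst r) Gp (FG _ _) (reach_param r p0 nEp0 Er))).
  by apply: filterS FA => p [_ nEp]; exact: reach_param.
pose w p := disp p (xi E p).
suff ww : w @ F --> w p0.
  have : translate p (w p) @[p --> F] --> translate p0 (w p0).
    exact: cvg_translate.
  by rewrite dispK; under eq_cvg do rewrite dispK.
pose B := (param (xi E p0) p0).2 + 1.
have FB : \forall p \near F, (param (xi E p) p).2 <= B.
  have Ex0 := xiE p0 Up0.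
  have : \forall p \near F, (param (xi E p0) p).2 <= B.
    by apply: (cvgr_le _ (Lcvg F _ PF (fun _ => id) Ex0)); rewrite ltrDl.
  by apply: filterS2 FA => p Ap; apply: le_trans; exact: Lle.
apply: (@cvg_of_compact _ _ F _ w _ _ (compact_box (B + pi * B ^+ 2))).
  apply: filterS2 FA FB => p [Up nEp] LB.
  have rp := reach_sym (reach_param _ _ nEp (xiE p Up)).
  have [Nle tle] := endpoint_le rp.
  have L0 : 0 < (param (xi E p) p).2 by case: rp.
  have B0 : 0 < B := lt_le_trans L0 LB.
  have LB2 : (param (xi E p) p).2 ^+ 2 <= B ^+ 2 by rewrite ler_sqr ?nnegrE// ltW.
  have piB : 0 <= pi * B ^+ 2 by rewrite mulr_ge0 ?pi_ge0 ?sqr_ge0.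
  have coord (c : R) : c ^+ 2 <= hnorm2 (w p) -> `|c| <= B + pi * B ^+ 2.
    move=> cN; apply: (@le_trans _ _ B); last by rewrite lerDl.
    rewrite -ler_sqr ?nnegrE ?(ltW B0)// real_normK ?num_real//.
    exact: le_trans cN (le_trans Nle LB2).
  have le_hnorm2 i : xc i (w p) ^+ 2 + yc i (w p) ^+ 2 <= hnorm2 (w p).
    rewrite /hnorm2 (bigD1 i)//= lerDl; apply: sumr_ge0 => j _.
    by rewrite addr_ge0 ?sqr_ge0.
  split; [|split] => [i|i|].
  - by apply/coord/(le_trans _ (le_hnorm2 i)); rewrite lerDl sqr_ge0.
  - by apply/coord/(le_trans _ (le_hnorm2 i)); rewrite lerDr sqr_ge0.
  - apply: (le_trans tle); rewrite -[leLHS]add0r lerD ?(ltW B0)//.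
    by rewrite ler_wpM2l ?pi_ge0.
move=> G PG FG w1 wG.
have Gp : p @[p --> G] --> p0 by apply: cvg_trans Fp => A; exact: FG.
pose q1 := translate p0 w1.
have xiG : xi E p @[p --> G] --> q1.
  have : translate p (w p) @[p --> G] --> translate p0 w1 by exact: cvg_translate.
  by under eq_cvg do rewrite dispK.
have Eq1 : E q1.
  have xE : \forall p \near G, E (xi E p).
    by apply: FG; apply: filterS FA => p [Up _]; exact: xiE.
  exact: (closed_cvg _ clE xE _ xiG).
suff : nearest E p0 q1.
  by move=> /(xi_uniq _ _ Up0) q1E; rewrite /w -q1E translateK.
split=> // r Er; rewrite !ccdist_param// lee_fin.
have rG : \forall p \near G,
    reach (xi E p) p (param (xi E p) p).1 (param (xi E p) p).2.
  apply: FG; apply: filterS FA => p [Up nEp].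
  by apply: reach_param => //; exact: xiE.
have [_ L1] := reach_cvg n0 xiG Gp rG (reach_param q1 p0 nEp0 Eq1).
apply: ler_cvg_to L1 (Lcvg G r PG FG Er) _.
by apply: FG; apply: filterS FA => p Ap; exact: Lle.
Qed.

Lemma curvature_cvg p0 : (Unp E `\` E) p0 ->
  curvature E p @[p --> within (Unp E `\` E) (nbhs p0)] --> curvature E p0.
Proof.
move=> Ap0; have [Up0 nEp0] := Ap0; have xicvg := xi_cvg p0 Ap0.
set F := within _ _ in xicvg *.
have PF : ProperFilter F.
  split; last exact: within_filter.
  by move=> /(@nbhs_singleton _ p0); exact.
have FA : \forall p \near F, (Unp E `\` E) p by exact: withinT.
have Fp : p @[p --> F] --> p0 by exact: cvg_within.
have rp p : (Unp E `\` E) p ->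
    reach (xi E p) p (param (xi E p) p).1 (param (xi E p) p).2.
  by move=> [Up nEp]; apply: reach_param => //; have [] := nearest_xi p Up.
have [xF LF] := reach_cvg n0 xicvg Fp (filterS rp FA) (rp p0 Ap0).
rewrite (curvature_reach n0 (rp p0 Ap0)).
have L0 : (param (xi E p0) p0).2 != 0 by case: (rp p0 Ap0) => /lt0r_neq0.
have : 2 * (param (xi E p) p).1 / (param (xi E p) p).2 @[p --> F] -->
    2 * (param (xi E p0) p0).1 / (param (xi E p0) p0).2.
  apply: cvgM; last exact: cvgV.
  by apply: cvgM => //; exact: cvg_cst.
apply: cvg_trans; apply: near_eq_cvg; apply: filterS FA => p Ap.
by rewrite (curvature_reach n0 (rp p Ap)).
Qed.

End NearestPoint.

Theorem proposition3p4 (R : realType) (n : nat) (hn : (1 <= n)%N)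
  (E : set (heis R n)) (hE : closed E) :
  {within Unp E `\` E, continuous (curvature E)}.
Proof. by apply/subspace_continuousP => p; exact: curvature_cvg. Qed.
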